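(* For every integer $t \geq 1$, there is a minor-closed graph class $\mathcal{L}_t$ of graphs of treewidth at most $3t-1$ such that for all simple graphs $G$ and $H$ it holds that $G \simeq_t^{\mathrm{L}} H$ if and only if $G \equiv_{\mathcal{L}_t} H$.
   Context: Graphs are finite, undirected, and without multiple edges; simple means without loops. For graphs $F,G$, $\hom(F,G)$ is the number of homomorphisms from $F$ to $G$, i.e. maps $V(F)\to V(G)$ sending edges to edges. For a class $\mathcal{F}$ of graphs, $G\equiv_{\mathcal{F}} H$ (homomorphism indistinguishability over $\mathcal{F}$) means $\hom(F,G)=\hom(F,H)$ for all $F\in\mathcal{F}$. A class is minor-closed if it is closed under taking graph minors. For a set $X$ and $k \in \mathbb{N}$, $\binom{X}{\leq k}$ is the set of subsets of $X$ of size at most $k$. An element $(g,h) \in V(G)\times V(H)$ is written $gh$. A set $\{g_1h_1,\dots,g_\ell h_\ell\} \subseteq V(G)\times V(H)$ is a partial isomorphism if for all $i,j\in[\ell]$: $g_i=g_j \Leftrightarrow h_i=h_j$, and $g_ig_j\in E(G) \Leftrightarrow h_ih_j \in E(H)$. $G \simeq_t^{\mathrm{L}} H$ means that the following system (the level-$t$ Lasserre relaxation for graph isomorphism) in real variables $y_I$, $I \in \binom{V(G)\times V(H)}{\leq 2t}$, is feasible: (i) the matrix $(y_{I\cup J})_{I,J\in\binom{V(G)\times V(H)}{\leq t}}$ is positive semidefinite; (ii) $\sum_{h\in V(H)} y_{I\cup\{gh\}} = y_I$ for all $I \in \binom{V(G)\times V(H)}{\leq 2t-2}$ and $g\in V(G)$;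 (iii) $\sum_{g\in V(G)} y_{I\cup\{gh\}} = y_I$ for all $I \in \binom{V(G)\times V(H)}{\leq 2t-2}$ and $h\in V(H)$; (iv) $y_I=0$ for every $I\in\binom{V(G)\times V(H)}{\leq 2t}$ that is not a partial isomorphism; (v) $y_\emptyset=1$. *)

(* Defs.v *)
From mathcomp Require Import all_boot all_order all_algebra.
From mathcomp Require Import sesquilinear reals.

Set Implicit Arguments.
Unset Strict Implicit.
Unset Printing Implicit Defensive.

Import Order.TTheory GRing.Theory Num.Theory.

(* Loops are allowed; multiple edges are excluded since [edge] is a relation. *)
Record graph := Graph {
  vertex :> finType;
  edge : rel vertex;
  edge_sym : symmetric edge }.

Definition simple (G : graph) : Prop := irreflexive (@edge G).

Definition is_hom (F G : graph) (f : {ffun F -> G}) : bool :=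
  [forall u, forall v, edge u v ==> edge (f u) (f v)].

Definition hom (F G : graph) : nat := #|[set f : {ffun F -> G} | is_hom f]|.

Definition hom_indistinguishable (L : graph -> Prop) (G H : graph) : Prop :=
  forall F : graph, L F -> hom F G = hom F H.

(* [A] induces a connected subgraph; this holds vacuously for [set0]. *)
Definition connected_in (G : graph) (A : {set G}) : Prop :=
  {in A &, forall u v,
     connect [rel x y | [&& x \in A, y \in A & edge x y]] u v}.

(* [M] is a minor of [G]: [phi x] is the set of vertices of [G] contracted to
   [x].  Contracting an edge of a graph without multiple edges does not create
   a loop (the contracted edge disappears, parallel edges are merged), so a
   loop of [M] at [x] has to come from a loop of [G] inside [phi x]; this is
   the role of the last conjunct. *)
Definition minor (M G : graph) : Prop :=
  exists phi : M -> {set G},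
    [/\ forall x, phi x != set0,
        forall x, connected_in (phi x),
        forall x y, x != y -> [disjoint phi x & phi y] &
        forall x y, edge x y ->
          exists u v : G,
            [/\ u \in phi x, v \in phi y, edge u v & x = y -> u = v]].

Definition minor_closed (L : graph -> Prop) : Prop :=
  forall M G : graph, minor M G -> L G -> L M.

Definition acyclic (T : graph) : Prop :=
  forall c : seq T, 2 < size c -> ~ ucycle (@edge T) c.

Definition is_tree (T : graph) : Prop :=
  [/\ simple T, 0 < #|T|, connected_in [set: T] & acyclic T].

Definition tree_decomposition (G T : graph) (B : T -> {set G}) : Prop :=
  [/\ is_tree T,
      forall v : G, exists x, v \in B x,
      forall u v : G, edge u v -> exists x, (u \in B x) && (v \in B x) &
      forall v : G, connected_in [set x | v \in B x]].

(* The width of a decomposition is the maximal size of a bag minus one. *)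
Definition treewidth_at_most (k : nat) (G : graph) : Prop :=
  exists (T : graph) (B : T -> {set G}),
    tree_decomposition B /\ forall x : T, #|B x| <= k.+1.

Definition partial_iso (G H : graph) (I : {set G * H}) : Prop :=
  {in I &, forall p q, (p.1 = q.1 <-> p.2 = q.2) /\
                       (edge p.1 q.1 <-> edge p.2 q.2)}.

Local Open Scope ring_scope.

Definition possemidef (R : realType) (n : nat) (A : 'M[R]_n) : Prop :=
  A \is symmetricmx /\ forall x : 'cV[R]_n, 0 <= (x^T *m A *m x) 0 0.

Definition set_le (X : finType) (k : nat) := {I : {set X} | (#|I| <= k)%N}.

Definition moment_matrix (R : realType) (X : finType) (t : nat)
    (y : {set X} -> R) : 'M[R]_#|{: set_le X t}| :=
  \matrix_(i, j) y (val (enum_val i) :|: val (enum_val j)).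

(* [y] is total for convenience: the constraints only involve its values at the
   sets of size at most 2t. *)
Definition lasserre_solution (R : realType) (t : nat) (G H : graph)
    (y : {set G * H} -> R) : Prop :=
  [/\ possemidef (moment_matrix t y),
      forall (I : {set G * H}) (g : G), (#|I| <= 2 * t - 2)%N ->
        \sum_(h : H) y (I :|: [set (g, h)]) = y I,
      forall (I : {set G * H}) (h : H), (#|I| <= 2 * t - 2)%N ->
        \sum_(g : G) y (I :|: [set (g, h)]) = y I,
      forall I : {set G * H}, (#|I| <= 2 * t)%N -> ~ partial_iso I -> y I = 0 &
      y set0 = 1].

Definition lasserre_feasible (R : realType) (t : nat) (G H : graph) : Prop :=
  exists y : {set G * H} -> R, lasserre_solution t y.

(* Main.v *)
Require Import Defs.
From mathcomp Require Import all_boot all_order all_algebra.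
From mathcomp Require Import all_fingroup sesquilinear.
From mathcomp Require Import reals boolp.
From mathcomp Require Import zify ring lra.

(* Let [C] be a set of [2 t] labels, split into two halves.  The class consists
   of the minors of the clique graphs of schemes: trees built from permutations
   of [C] and from series compositions, which identify the right labels of one
   factor with the left labels of the other.  A series composition needs a bag
   of three blocks of [t] vertices, whence treewidth at most [3 t - 1].  A graph
   of the class amounts to a scheme with edge and equality constraints, and its
   homomorphism number to the sum of the entries of the tensor [ev] that counts
   the extensions of a labelling of [C].

   A Lasserre solution is a kernel [Z] between [C]-tuples of [G] and [C]-tuples
   of [H].  If [Z] maps [M] to [N] and its transpose maps [N] back to [M], then
   positivity forces [M] and [N] to intertwine the Gram vectors of [Z], because
   the sum of the squared norms of the defects is [|M|^2 - 2 <Z M, N> + |N|^2 = 0].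
   Hence the tensors transported by [Z] are closed under series composition, and
   [Z] preserves sums of entries.

   Conversely, if all sums agree, then so do all inner products, so that the
   tensors over [G] and those over [H] are related by an isometry.  Extended by
   zero on the orthogonal complement it becomes a kernel [Z].  It commutes with
   every operation that, together with its adjoint, preserves the family of
   tensors; this gives all the linear constraints.  It is positive semidefinite
   because on its own image it acts as multiplication by a sum of Gram matrices. *)

Set Implicit Arguments.
Unset Strict Implicit.
Unset Printing Implicit Defensive.

(** * Minors and treewidth *)

Lemma connected_edge (G : graph) (A : {set G}) (u v : G) :
  u \in A -> v \in A -> edge u v ->
  connect [rel x y | [&& x \in A, y \in A & edge x y]] u v.
Proof. by move=> uA vA uv; apply: connect1; rewrite /= uA vA. Qed.

Lemma connect_restrict_sub (G : graph) (A B : {set G}) (u v : G) :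
  A \subset B ->
  connect [rel x y | [&& x \in A, y \in A & edge x y]] u v ->
  connect [rel x y | [&& x \in B, y \in B & edge x y]] u v.
Proof.
move=> /subsetP sAB; apply: connect_sub => x y /= /and3P[xA yA xy].
exact: connected_edge (sAB _ xA) (sAB _ yA) xy.
Qed.

Lemma connected_in_sym (G : graph) (A : {set G}) :
  connect_sym [rel x y : G | [&& x \in A, y \in A & edge x y]].
Proof.
apply: sym_connect_sym => x y /=.
by rewrite edge_sym; case: (x \in A); case: (y \in A).
Qed.

(* A connected index set whose adjacent members have overlapping connected
   images glues to a connected set; this serves both transitivity of the minor
   relation and the minor monotonicity of treewidth. *)
Lemma connected_glue (G N : graph) (P : {set N}) (phi : N -> {set G})
    (B : {set G}) :
  connected_in P -> (forall x, x \in P -> phi x \subset B) ->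
  (forall x, x \in P -> connected_in (phi x)) ->
  (forall x, x \in P -> phi x != set0) ->
  (forall x y, x \in P -> y \in P -> edge x y -> exists u v,
     [/\ u \in phi x, v \in phi y &
       connect [rel u v | [&& u \in B, v \in B & edge u v]] u v]) ->
  forall x y u v, x \in P -> y \in P -> u \in phi x -> v \in phi y ->
     connect [rel u v | [&& u \in B, v \in B & edge u v]] u v.
Proof.
move=> conP sub con ne step x y u v xP yP ux vy.
have /connectP[p] := conP _ _ xP yP.
elim: p x xP u ux => [|z p IH] x xP u ux /=.
  move=> _ yx; move: vy; rewrite yx => vx.
  exact: connect_restrict_sub (sub _ xP) (con _ xP _ _ ux vx).
case/andP=> /and3P[_ zP xz] pth yl.
have [u1 [v1 [u1x v1z c]]] := step _ _ xP zP xz.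
apply: connect_trans (IH _ zP _ v1z pth yl).
apply: connect_trans c.
exact: connect_restrict_sub (sub _ xP) (con _ xP _ _ ux u1x).
Qed.

Lemma minor_trans (M N G : graph) : minor M N -> minor N G -> minor M G.
Proof.
move=> [phi [ne1 con1 dis1 ed1]] [psi [ne2 con2 dis2 ed2]].
exists (fun x => \bigcup_(y in phi x) psi y); split.
- move=> x; have /set0Pn[y yx] := ne1 x; have /set0Pn[z zy] := ne2 y.
  by apply/set0Pn; exists z; apply/bigcupP; exists y.
- move=> x u v /bigcupP[y yx uy] /bigcupP[z zx vz].
  apply: (connected_glue (P := phi x) (phi := psi) _ _ _ _ _ yx zx uy vz) => //.
  + by move=> w wx; apply: bigcup_sup.
  + move=> a b aP bP ab; have [u1 [v1 [u1a v1b e _]]] := ed2 _ _ ab.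
    exists u1, v1; split=> //; apply: connected_edge => //.
      by apply/bigcupP; exists a.
    by apply/bigcupP; exists b.
- move=> x y xy; rewrite -setI_eq0; apply/eqP/setP=> z; rewrite !inE.
  apply/negP=> /andP[/bigcupP[a ax za] /bigcupP[b yb zb]].
  have [ab|ab] := eqVneq a b.
    have := dis1 _ _ xy; rewrite -setI_eq0 => /eqP/setP/(_ a).
    by rewrite !inE ax ab yb.
  have := dis2 _ _ ab; rewrite -setI_eq0 => /eqP/setP/(_ z).
  by rewrite !inE za zb.
- move=> x y /ed1[a [b [ax yb ab xy]]].
  have [u [v [ua vb uv]]] := ed2 _ _ ab => eq.
  exists u, v; split=> //.
  + by apply/bigcupP; exists a.
  + by apply/bigcupP; exists b.
  + by move/xy/eq.
Qed.

(** A vertex of the minor is put into every bag that its branch set meets. Branch sets are disjoint,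
    so bags do not grow; they are connected, so [connected_glue] applies. *)
Lemma treewidth_minor (k : nat) (M G : graph) :
  minor M G -> treewidth_at_most k G -> treewidth_at_most k M.
Proof.
move=> [phi [ne con dis ed]] [T [B [[tT cov edB conB] sz]]].
exists T, (fun x => [set m | phi m :&: B x != set0]); split; last first.
  move=> x; apply: leq_trans (sz x).
  (* One vertex of the old bag for each member of the new one; disjointness makes the choice
     injective. *)
  pose rep (m : M) := [pick v | v \in phi m :&: B x].
  have sj : injective (@Some G) by move=> ? ? [].
  rewrite -(card_imset (B x) sj).
  rewrite -(card_in_imset (f := rep)); last first.
    move=> m m'; rewrite !inE /rep => /set0Pn[v vm] /set0Pn[v' vm'].
    case: pickP => [w wm|/(_ v)]; last by rewrite vm.
    case: pickP => [w' wm'|/(_ v')]; last by rewrite vm'.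
    case=> ww'; subst w'; have [//|/dis] := eqVneq m m'.
    rewrite -setI_eq0 => /eqP/setP/(_ w); move: wm wm'; rewrite !inE.
    by case/andP=> -> _ /andP[-> _].
  apply/subset_leq_card/subsetP=> o /imsetP[m]; rewrite inE /rep.
  case/set0Pn=> v vm; case: pickP => [w|/(_ v)]; last by rewrite vm.
  by rewrite inE => /andP[_ wB] ->; apply/imset_f.
split=> //.
- move=> m; have /set0Pn[v vm] := ne m; have [x vx] := cov v.
  by exists x; rewrite inE; apply/set0Pn; exists v; rewrite inE vm.
- move=> m m' /ed[u [v [um vm uv _]]]; have [x /andP[ux vx]] := edB _ _ uv.
  exists x; rewrite !inE; apply/andP.
  by split; apply/set0Pn; [exists u | exists v]; rewrite inE ?um ?vm.
- move=> m x y; rewrite !inE => /set0Pn[u] /setIP[um ux].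
  case/set0Pn=> v /setIP[vm vy].
  have {}ux : x \in [set z | u \in B z] by rewrite inE.
  have {}vy : y \in [set z | v \in B z] by rewrite inE.
  apply: (connected_glue (N := G) (P := phi m)
    (phi := fun w => [set z | w \in B z]) _ _ _ _ _ um vm ux vy) => //.
  + move=> w wm; apply/subsetP=> z; rewrite !inE => wz.
    by apply/set0Pn; exists w; rewrite inE wm.
  + by move=> w _; have [z wz] := cov w; apply/set0Pn; exists z; rewrite inE.
  + move=> w w' wm wm' ww'; have [z /andP[wz wz']] := edB _ _ ww'.
    by exists z, z; rewrite !inE; split.
Qed.

(** On a cycle, a vertex of maximal rank would have two distinct neighbours of no larger rank. *)
Lemma acyclic_rank (T : graph) (r : T -> nat) :
  (forall x y z, edge x y -> edge x z -> r y <= r x -> r z <= r x -> y = z) ->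
  acyclic T.
Proof.
move=> low c c3 uc.
have [x0 x0c] : exists x, x \in c by case: c c3 uc => // x c; exists x; rewrite mem_head.
case: (arg_maxnP r x0c) => x xc xmax.
case: (rot_to xc) => i c' ec.
have: ucycle (@edge T) (x :: c') by rewrite -ec /ucycle rot_cycle rot_uniq.
have : 2 < size (x :: c') by rewrite -ec size_rot.
have mem z : z \in c' -> r z <= r x.
  move=> zc; suff: z \in c by exact: xmax.
  by rewrite -(mem_rot i c) ec inE zc orbT.
(* The rotated cycle reads [x, y, ..., z], so [y] and [z] are the two neighbours of [x]. *)
case: c' ec mem => [//|y c'] ec mem; case: (lastP c') ec mem => [//|p z] ec mem _.
rewrite /ucycle /= rcons_path last_rcons => /andP[/and3P[xy _ zx]].
case/and3P=> _ + _; rewrite mem_rcons inE negb_or => /andP[yz _].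
have : y = z; last by move=> eyz; rewrite eyz eqxx in yz.
apply: (low x) => //.
- by rewrite edge_sym.
- by apply: mem; rewrite mem_head.
- by apply: mem; rewrite inE mem_rcons mem_head orbT.
Qed.

(** * Schemes and their tree decompositions *)

Definition ctx (t : nat) : finType := ('I_t + 'I_t)%type.

Inductive scheme (t : nat) : Type :=
| Leaf
| Ren of {perm ctx t} & scheme t
| Ser of scheme t & scheme t.
Arguments Leaf {t}.

(** The vertices other than the [2 t] labels. Each series composition binds the [t] labels along
    which it glues. *)
Fixpoint bound t (s : scheme t) : finType :=
  match s with
  | Leaf => void
  | Ren _ s1 => bound s1
  | Ser s1 s2 => ('I_t + (bound s1 + bound s2))%type
  end.

Definition var t (s : scheme t) : finType := (ctx t + bound s)%type.

Definition ren_var t (p : {perm ctx t}) (s : scheme t) (v : var s) :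
    var (Ren p s) :=
  match v with inl c => inl (p c) | inr b => inr b end.

Definition ser_var1 t (s1 s2 : scheme t) (v : var s1) : var (Ser s1 s2) :=
  match v with
  | inl (inl i) => inl (inl i)
  | inl (inr i) => inr (inl i)
  | inr b => inr (inr (inl b))
  end.

Definition ser_var2 t (s1 s2 : scheme t) (v : var s2) : var (Ser s1 s2) :=
  match v with
  | inl (inl i) => inr (inl i)
  | inl (inr i) => inl (inr i)
  | inr b => inr (inr (inr b))
  end.

(* The relations at a [Ren] node constrain its [2 t] labels: [true] selects the
   edge constraints, [false] the equality constraints. *)
Fixpoint ann t (s : scheme t) : Type :=
  match s with
  | Leaf => unit
  | Ren _ s1 => ((bool -> rel (ctx t)) * ann s1)%type
  | Ser s1 s2 => (ann s1 * ann s2)%type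
  end.

Definition push (A B : finType) (f : A -> B) (r : rel A) : rel B :=
  fun u v => [exists x, exists y, [&& f x == u, f y == v & r x y]].

Lemma pushP (A B : finType) (f : A -> B) (r : rel A) u v :
  reflect (exists x y, [/\ f x = u, f y = v & r x y]) (push f r u v).
Proof.
apply: (iffP existsP) => [[x /existsP[y /and3P[/eqP <- /eqP <- xy]]]|].
  by exists x, y.
move=> [x [y [<- <- xy]]]; exists x; apply/existsP; exists y.
by rewrite !eqxx.
Qed.

Fixpoint constr t (s : scheme t) : ann s -> bool -> rel (var s) :=
  match s with
  | Leaf => fun _ _ _ _ => false
  | Ren p s1 => fun a b u v =>
      push (inl : ctx t -> var (Ren p s1)) (a.1 b) u v
      || push (ren_var p (s:=s1)) (constr a.2 b) u v
  | Ser s1 s2 => fun a b u v =>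
      push (ser_var1 s2 (s1:=s1)) (constr a.1 b) u v
      || push (ser_var2 s1 (s2:=s2)) (constr a.2 b) u v
  end.

(** Loops are included on purpose: an edge constraint between two glued vertices becomes a loop of
    the quotient, and a loop of a minor must come from a loop. *)
Fixpoint full_ann t (s : scheme t) : ann s :=
  match s with
  | Leaf => tt
  | Ren _ s1 => (fun _ _ _ => true, full_ann s1)
  | Ser s1 s2 => (full_ann s1, full_ann s2)
  end.

Definition clique t (s : scheme t) : rel (var s) := constr (full_ann s) true.

Lemma clique_sym t (s : scheme t) : symmetric (clique (s := s)).
Proof.
have sym (A B : finType) (f : A -> B) (r : rel A) :
    (forall x y, r x y -> r y x) -> forall x y, push f r x y -> push f r y x.
  move=> rs u v /pushP[x [y [<- <- xy]]]; apply/pushP.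
  by exists y, x; split=> //; apply: rs.
suff h u v : clique (s := s) u v -> clique (s := s) v u.
  by move=> u v; apply/idP/idP; apply: h.
rewrite /clique; elim: s u v => [|p s IH|s1 IH1 s2 IH2] //= u v /orP[] h.
- by apply/orP; left; apply: sym h.
- by apply/orP; right; apply: sym h.
- by apply/orP; left; apply: sym h.
- by apply/orP; right; apply: sym h.
Qed.

Definition scheme_graph t (s : scheme t) : graph := Graph (clique_sym (s := s)).

Definition lasserre_class (t : nat) (F : graph) : Prop :=
  exists s : scheme t, minor F (scheme_graph s).

Lemma lasserre_class_minor t : minor_closed (lasserre_class t).
Proof. by move=> M G MG [s Gs]; exists s; apply: minor_trans Gs. Qed.

(** * The tree decomposition of a clique graph *)

Fixpoint node t (s : scheme t) : finType :=
  match s with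
  | Leaf => unit
  | Ren _ s1 => node s1
  | Ser s1 s2 => option (node s1 + node s2)
  end.

Fixpoint root_node t (s : scheme t) : node s :=
  match s with
  | Leaf => tt
  | Ren _ s1 => root_node s1
  | Ser s1 s2 => None
  end.

Fixpoint depth t (s : scheme t) : node s -> nat :=
  match s with
  | Leaf => fun _ => 0
  | Ren _ s1 => depth (s := s1)
  | Ser s1 s2 => fun x => match x with
      | None => 0
      | Some (inl y) => (depth y).+1
      | Some (inr y) => (depth y).+1
      end
  end.

Fixpoint node_edge t (s : scheme t) : rel (node s) :=
  match s with
  | Leaf => fun _ _ => false
  | Ren _ s1 => node_edge (s := s1)
  | Ser s1 s2 => fun x y => match x, y with
      | None, Some (inl z) => z == root_node s1
      | None, Some (inr z) => z == root_node s2
      | Some (inl z), None => z == root_node s1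
      | Some (inr z), None => z == root_node s2
      | Some (inl z), Some (inl w) => node_edge (s := s1) z w
      | Some (inr z), Some (inr w) => node_edge (s := s2) z w
      | _, _ => false
      end
  end.

Lemma node_edge_sym t (s : scheme t) : symmetric (node_edge (s := s)).
Proof.
by elim: s => [|p s IH|s1 IH1 s2 IH2] //= [[x|x]|] [[y|y]|] /=.
Qed.

Definition node_tree t (s : scheme t) : graph := Graph (node_edge_sym (s := s)).

Fixpoint bag t (s : scheme t) : node s -> {set var s} :=
  match s with
  | Leaf => fun _ => [set: var Leaf]
  | Ren p s1 => fun x => (ren_var p (s := s1)) @: bag (s := s1) x
  | Ser s1 s2 => fun x => match x with
      | None => [set v | match v with inr (inr _) => false | _ => true end]
      | Some (inl y) => (ser_var1 s2 (s1 := s1)) @: bag (s := s1) y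
      | Some (inr y) => (ser_var2 s1 (s2 := s2)) @: bag (s := s2) y
      end
  end.

Lemma depth_root t (s : scheme t) : depth (root_node s) = 0.
Proof. by elim: s. Qed.

Lemma depth_root_edge t (s : scheme t) (x : node s) :
  node_edge (root_node s) x -> 0 < depth x.
Proof.
elim: s x => [|p s IH|s1 IH1 s2 IH2] //=.
by case=> [[x|x]|].
Qed.

(** All neighbours of a node except its parent are strictly deeper. This is the hypothesis of
    [acyclic_rank] for [depth]. *)
Lemma node_edge_low t (s : scheme t) (x y z : node s) :
  node_edge x y -> node_edge x z -> depth y <= depth x ->
  depth z <= depth x -> y = z.
Proof.
elim: s x y z => [|p s IH|s1 IH1 s2 IH2] //=.
have low (s : scheme t) (x y : node s) : x == root_node s -> node_edge x y ->
    depth y <= depth x -> False.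
  move=> /eqP -> /depth_root_edge; rewrite depth_root.
  by case: (depth y).
case=> [[x|x]|] [[y|y]|] [[z|z]|] //=; rewrite ?ltnS ?ltn0 //.
- by move=> xy xz yx zx; rewrite (IH1 _ _ _ xy xz yx zx).
- by move=> xy xr yx _; case: (low _ _ _ xr xy yx).
- by move=> xr xz _ zx; case: (low _ _ _ xr xz zx).
- by move=> xy xz yx zx; rewrite (IH2 _ _ _ xy xz yx zx).
- by move=> xy xr yx _; case: (low _ _ _ xr xy yx).
- by move=> xr xz _ zx; case: (low _ _ _ xr xz zx).
Qed.

Lemma node_simple t (s : scheme t) : irreflexive (node_edge (s := s)).
Proof.
elim: s => [|p s IH|s1 IH1 s2 IH2] //=.
by case=> [[x|x]|] /=.
Qed.

Definition conn_node t (s : scheme t) (A : {set node s}) :=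
  connect [rel x y : node s | [&& x \in A, y \in A & node_edge x y]].

Lemma conn_node_trans t (s : scheme t) (A : {set node s}) y x z :
  conn_node A x y -> conn_node A y z -> conn_node A x z.
Proof. exact: connect_trans. Qed.

Lemma connect_img (T T' : finType) (e : rel T) (e' : rel T') (f : T -> T') :
  (forall x y, e x y -> e' (f x) (f y)) ->
  forall x y, connect e x y -> connect e' (f x) (f y).
Proof.
move=> h x y /connectP[p + ->]; elim: p x => [|z p IH] x //=.
case/andP=> /h xz /IH; apply: connect_trans; exact: connect1.
Qed.

Lemma conn_node_inl t (s1 s2 : scheme t) (A : {set node (Ser s1 s2)})
    (B : {set node s1}) x y :
  (forall z, z \in B -> (Some (inl z) : node (Ser s1 s2)) \in A) -> conn_node B x y ->
  conn_node A (Some (inl x)) (Some (inl y)).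
Proof.
move=> h; apply: (connect_img (f := fun z => Some (inl z))) => {x y}x y /=.
by case/and3P=> /h -> /h -> ->.
Qed.

Lemma conn_node_inr t (s1 s2 : scheme t) (A : {set node (Ser s1 s2)})
    (B : {set node s2}) x y :
  (forall z, z \in B -> (Some (inr z) : node (Ser s1 s2)) \in A) -> conn_node B x y ->
  conn_node A (Some (inr x)) (Some (inr y)).
Proof.
move=> h; apply: (connect_img (f := fun z => Some (inr z))) => {x y}x y /=.
by case/and3P=> /h -> /h -> ->.
Qed.

Lemma ser_var1_inj t (s1 s2 : scheme t) : injective (ser_var1 s2 (s1 := s1)).
Proof. by move=> [[i|i]|b] [[j|j]|c] //= [->]. Qed.

Lemma ser_var2_inj t (s1 s2 : scheme t) : injective (ser_var2 s1 (s2 := s2)).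
Proof. by move=> [[i|i]|b] [[j|j]|c] //= [->]. Qed.

Lemma ren_var_inj t p (s : scheme t) : injective (ren_var p (s := s)).
Proof. by move=> [i|b] [j|c] //= [] /perm_inj ->. Qed.

Lemma node_connected t (s : scheme t) (x : node s) :
  conn_node [set: node s] (root_node s) x.
Proof.
elim: s x => [|p s IH|s1 IH1 s2 IH2] /=.
- by case; apply: connect0.
- exact: IH.
- case=> [[x|x]|]; last exact: connect0.
  + apply: (@conn_node_trans _ (Ser s1 s2) _ (Some (inl (root_node s1)))).
      by apply: connect1; rewrite /= !inE /=.
    by apply: conn_node_inl (IH1 x) => z; rewrite !inE.
  + apply: (@conn_node_trans _ (Ser s1 s2) _ (Some (inr (root_node s2)))).
      by apply: connect1; rewrite /= !inE /=.
    by apply: conn_node_inr (IH2 x) => z; rewrite !inE.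
Qed.

Lemma root_bag t (s : scheme t) (c : ctx t) : inl c \in bag (root_node s).
Proof.
elim: s c => [|p s IH|s1 IH1 s2 IH2] c //=; rewrite ?inE //.
by apply/imsetP; exists (inl (p^-1%g c)); rewrite ?IH //= permKV.
Qed.

(* Every bag family has a top node; for labels it is the root, which is what
   lets the decompositions of the two factors be hung below a new root. *)
Lemma bag_connected t (s : scheme t) (v : var s) :
  exists top, [/\ v \in bag top,
    forall x, v \in bag x -> conn_node [set y | v \in bag y] top x &
    if v is inl _ then top = root_node s else True].
Proof.
elim: s v => [|p s IH|s1 IH1 s2 IH2] /= v.
- exists tt; split; rewrite ?inE //; last by case: v.
  by case=> _; apply: connect0.
- pose w : var s := match v with inl c => inl (p^-1%g c) | inr b => inr b end.
  have -> : v = ren_var p w by rewrite /w; case: v {w} => //= c; rewrite permKV.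
  have [top [vt ht rt]] := IH w; exists top; split.
  + by rewrite mem_imset //; apply: ren_var_inj.
  + move=> x; rewrite mem_imset; last exact: ren_var_inj.
    move=> /ht; congr (conn_node _ top x); apply/setP=> y.
    by rewrite !inE mem_imset //; apply: ren_var_inj.
  + by case: w rt {vt ht}.
- have m1 (w : var s1) y : (ser_var1 s2 w \in (ser_var1 s2 (s1 := s1)) @: bag y)
      = (w \in bag y) by rewrite mem_imset //; apply: ser_var1_inj.
  have m2 (w : var s2) y : (ser_var2 s1 w \in (ser_var2 s1 (s2 := s2)) @: bag y)
      = (w \in bag y) by rewrite mem_imset //; apply: ser_var2_inj.
  (* A label of a factor lies in the bag of the new root and in the root bag of that factor, so its
     bags stay connected across the new tree edge. *)
  have c1 (w : var s1) x : w \in bag x -> (if w is inl _ then True else False) ->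
      conn_node [set y | ser_var1 s2 w \in @bag t (Ser s1 s2) y]
        None (Some (inl x)).
    move=> wx; case: w wx => // c cx _.
    have [top [_ ht rt]] := IH1 (inl c).
    apply: (@conn_node_trans _ (Ser s1 s2) _ (Some (inl (root_node s1)))).
      apply/connect1/and3P; split; last exact: eqxx.
        by rewrite inE; case: c {cx ht rt} => i; rewrite /= ?inE.
      by rewrite inE; have := root_bag s1 c; rewrite -m1.
    rewrite rt in ht; apply: (conn_node_inl _ (ht _ cx)) => z.
    by rewrite !inE m1.
  have c2 (w : var s2) x : w \in bag x -> (if w is inl _ then True else False) ->
      conn_node [set y | ser_var2 s1 w \in @bag t (Ser s1 s2) y]
        None (Some (inr x)).
    move=> wx; case: w wx => // c cx _.
    have [top [_ ht rt]] := IH2 (inl c).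
    apply: (@conn_node_trans _ (Ser s1 s2) _ (Some (inr (root_node s2)))).
      apply/connect1/and3P; split; last exact: eqxx.
        by rewrite inE; case: c {cx ht rt} => i; rewrite /= ?inE.
      by rewrite inE; have := root_bag s2 c; rewrite -m2.
    rewrite rt in ht; apply: (conn_node_inr _ (ht _ cx)) => z.
    by rewrite !inE m2.
  have inv1 (w : var (Ser s1 s2)) (y : node s1) : w \in (ser_var1 s2 (s1 := s1)) @: bag y ->
      exists2 w', w = ser_var1 s2 w' & w' \in bag y.
    by case/imsetP=> w' ? ->; exists w'.
  have inv2 (w : var (Ser s1 s2)) (y : node s2) : w \in (ser_var2 s1 (s2 := s2)) @: bag y ->
      exists2 w', w = ser_var2 s1 w' & w' \in bag y.
    by case/imsetP=> w' ? ->; exists w'.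
  case: v => [c|[i|[b|b]]].
  + exists None; split=> //; first by rewrite inE.
    case=> [[x|x]|] h; last exact: connect0.
      have [w ew wx] := inv1 _ _ h; rewrite ew; apply: c1 => //.
      by case: w ew {wx} => [[j|j]|j].
    have [w ew wx] := inv2 _ _ h; rewrite ew; apply: c2 => //.
    by case: w ew {wx} => [[j|j]|j].
  + exists None; split=> //; first by rewrite inE.
    case=> [[x|x]|] h; last exact: connect0.
      have [w ew wx] := inv1 _ _ h; rewrite ew; apply: c1 => //.
      by case: w ew {wx} => [[j|j]|j].
    have [w ew wx] := inv2 _ _ h; rewrite ew; apply: c2 => //.
    by case: w ew {wx} => [[j|j]|j].
  + have [top [vt ht _]] := IH1 (inr b); exists (Some (inl top)).
    have eb : inr (inr (inl b)) = ser_var1 s2 (inr b : var s1) by [].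
    split=> //; first by rewrite eb m1.
    case=> [[x|x]|].
    * rewrite eb m1 => /ht; apply: conn_node_inl => y.
      by rewrite !inE m1.
    * by move=> /inv2[w ew _]; case: w ew => [[j|j]|j].
    * by rewrite inE.
  + have [top [vt ht _]] := IH2 (inr b); exists (Some (inr top)).
    have eb : inr (inr (inr b)) = ser_var2 s1 (inr b : var s2) by [].
    split=> //; first by rewrite eb m2.
    case=> [[x|x]|].
    * by move=> /inv1[w ew _]; case: w ew => [[j|j]|j].
    * rewrite eb m2 => /ht; apply: conn_node_inr => y.
      by rewrite !inE m2.
    * by rewrite inE.
Qed.

Lemma bag_card t (s : scheme t) (x : node s) : #|bag x| <= 3 * t.
Proof.
elim: s x => [|p s IH|s1 IH1 s2 IH2] /= x.
- rewrite cardsT /var /= !card_sum card_void !card_ord addn0 addnn -mul2n.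
  by rewrite leq_mul2r orbT.
- by rewrite card_imset; [apply: IH | apply: ren_var_inj].
- case: x => [[x|x]|].
  + by rewrite card_imset; [apply: IH1 | apply: ser_var1_inj].
  + by rewrite card_imset; [apply: IH2 | apply: ser_var2_inj].
  + pose f (z : ctx t + 'I_t) : var (Ser s1 s2) :=
      match z with inl c => inl c | inr i => inr (inl i) end.
    have <- : #|{: ctx t + 'I_t}| = 3 * t.
      by rewrite !card_sum !card_ord !mulSn mul0n addn0 addnA.
    have fi : injective f by move=> [c|i] [d|j] //= [->].
    rewrite -cardsT -(card_imset _ fi); apply/subset_leq_card/subsetP.
    case=> [c|[i|b]]; rewrite inE // => _.
      by apply/imsetP; exists (inl c).
    by apply/imsetP; exists (inr i).
Qed.

Lemma clique_bag t (s : scheme t) (u v : var s) :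
  clique u v -> exists x, (u \in bag x) && (v \in bag x).
Proof.
rewrite /clique; elim: s u v => [|p s IH|s1 IH1 s2 IH2] //= u v /orP[]
  /pushP[x [y [<- <- xy]]].
- by exists (root_node s); rewrite !(@root_bag t (Ren p s)).
- have [z /andP[xz yz]] := IH _ _ xy.
  by exists z; rewrite !imset_f.
- have [z /andP[xz yz]] := IH1 _ _ xy.
  by exists (Some (inl z)); rewrite !imset_f.
- have [z /andP[xz yz]] := IH2 _ _ xy.
  by exists (Some (inr z)); rewrite !imset_f.
Qed.

Lemma scheme_treewidth t (s : scheme t) :
  0 < t -> treewidth_at_most (3 * t - 1) (scheme_graph s).
Proof.
move=> t0; exists (node_tree s), (bag (s := s)); split; last first.
  move=> x; apply: leq_trans (bag_card x) _; rewrite subn1.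
  by case: (3 * t).
split.
- split.
  + exact: node_simple.
  + by apply/card_gt0P; exists (root_node s).
  + move=> x y _ _; apply: (@connect_trans _ _ (root_node s)).
      by rewrite (@connected_in_sym (node_tree s)); apply: node_connected.
    exact: node_connected.
  + by apply: (@acyclic_rank (node_tree s) (depth (s := s))) => x y z; apply: node_edge_low.
- by move=> v; have [x [vx _ _]] := bag_connected v; exists x.
- by move=> u v; apply: clique_bag.
- move=> v x y; rewrite !inE => vx vy; have [z [_ h _]] := bag_connected v.
  apply: (@connect_trans _ _ z); last exact: h.
  by rewrite (@connected_in_sym (node_tree s)); apply: h.
Qed.

(** * Constrained schemes and homomorphism numbers *)

Definition fjoin (A B : finType) (T : Type) (f : {ffun A -> T})
    (g : {ffun B -> T}) : {ffun A + B -> T} :=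
  [ffun c => match c with inl a => f a | inr b => g b end].

Definition lpart (A B : finType) (T : Type) (x : {ffun A + B -> T}) :
  {ffun A -> T} := [ffun a => x (inl a)].

Definition rpart (A B : finType) (T : Type) (x : {ffun A + B -> T}) :
  {ffun B -> T} := [ffun b => x (inr b)].

Lemma fjoinK1 (A B : finType) (T : Type) (f : {ffun A -> T})
  (g : {ffun B -> T}) : lpart (fjoin f g) = f.
Proof. by apply/ffunP=> a; rewrite !ffunE. Qed.

Lemma fjoinK2 (A B : finType) (T : Type) (f : {ffun A -> T})
  (g : {ffun B -> T}) : rpart (fjoin f g) = g.
Proof. by apply/ffunP=> a; rewrite !ffunE. Qed.

Lemma fjoin_parts (A B : finType) (T : Type) (x : {ffun A + B -> T}) :
  fjoin (lpart x) (rpart x) = x.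
Proof. by apply/ffunP=> -[a|b]; rewrite !ffunE. Qed.

Lemma big_fjoin (R : Type) (idx : R) (op : Monoid.com_law idx)
    (A B T : finType) (F : {ffun A + B -> T} -> R) :
  \big[op/idx]_x F x = \big[op/idx]_f \big[op/idx]_g F (fjoin f g).
Proof.
rewrite pair_big (reindex (fun p => fjoin p.1 p.2)) //=.
exists (fun x => (lpart x, rpart x)) => [[f g]|x] _ /=.
  by rewrite fjoinK1 fjoinK2.
by rewrite fjoin_parts.
Qed.

Definition compat (G : graph) (V : finType) (cs : bool -> rel V)
    (f : {ffun V -> G}) : bool :=
  [forall u, forall v, (cs true u v ==> edge (f u) (f v)) &&
                       (cs false u v ==> (f u == f v))].

Lemma compatP (G : graph) (V : finType) (cs : bool -> rel V) (f : {ffun V -> G}) :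
  reflect (forall u v, (cs true u v -> edge (f u) (f v)) /\
                       (cs false u v -> f u = f v)) (compat cs f).
Proof.
apply: (iffP forallP) => h u.
  move=> v; have /forallP/(_ v)/andP[/implyP h1 /implyP h2] := h u.
  by split=> // /h2/eqP.
apply/forallP=> v; have [h1 h2] := h u v.
by apply/andP; split; apply/implyP => // /h2 ->.
Qed.

Lemma compat_or (G : graph) (V : finType) (cs1 cs2 : bool -> rel V)
    (f : {ffun V -> G}) :
  compat (fun b u v => cs1 b u v || cs2 b u v) f = compat cs1 f && compat cs2 f.
Proof.
apply/compatP/andP => [h|[/compatP h1 /compatP h2] u v].
  by split; apply/compatP=> u v; have [h1 h2] := h u v; split=> c;
    do [apply: h1 | apply: h2]; rewrite c ?orbT.
have [h3 h4] := h1 u v; have [h5 h6] := h2 u v.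
by split; case/orP.
Qed.

Lemma compat_push (G : graph) (U V : finType) (i : U -> V) (cs : bool -> rel U)
    (f : {ffun V -> G}) :
  compat (fun b => push i (cs b)) f = compat cs [ffun u => f (i u)].
Proof.
apply/compatP/compatP => h u v.
  have [h1 h2] := h (i u) (i v); rewrite !ffunE.
  by split=> c; [apply: h1 | apply: h2]; apply/pushP; exists u, v.
by split=> /pushP[x [y [<- <- c]]]; have := h x y; rewrite !ffunE => -[]; auto.
Qed.

Definition ev t (s : scheme t) (a : ann s) (G : graph) (x : {ffun ctx t -> G}) :
  nat := \sum_(b : {ffun bound s -> G}) compat (constr a) (fjoin x b).

Lemma ev_leaf t a (G : graph) (x : {ffun ctx t -> G}) : ev (s := Leaf) a x = 1.
Proof.
rewrite /ev (eq_bigr (fun=> 1)); last first.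
  move=> b _; suff -> : compat (constr (s := Leaf) a) (fjoin x b) by [].
  by apply/compatP.
by rewrite sum_nat_const muln1 card_ffun card_void.
Qed.

Lemma ev_ren t p (s : scheme t) (a : ann (Ren p s)) (G : graph)
    (x : {ffun ctx t -> G}) :
  ev a x = compat a.1 x * ev a.2 [ffun c => x (p c)].
Proof.
rewrite /ev big_distrr /=; apply: eq_bigr => b _; rewrite mulnb; congr nat_of_bool.
rewrite compat_or !compat_push; congr (_ && _); apply: (congr1 (compat _)).
  by apply/ffunP=> c; rewrite !ffunE.
by apply/ffunP=> -[c|c]; rewrite !ffunE //= ffunE.
Qed.

(** Once the glued block [y] is fixed, the two factors share no bound vertex, and the count of
    extensions factorises. *)
Lemma ev_ser t (s1 s2 : scheme t) (a : ann (Ser s1 s2)) (G : graph)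
    (x : {ffun ctx t -> G}) :
  ev a x = \sum_(y : {ffun 'I_t -> G})
    ev a.1 (fjoin (lpart x) y) * ev a.2 (fjoin y (rpart x)).
Proof.
rewrite /ev big_fjoin /=; apply: eq_bigr => y _.
rewrite big_fjoin big_distrl /=; apply: eq_bigr => b1 _.
rewrite big_distrr /=; apply: eq_bigr => b2 _; rewrite mulnb; congr nat_of_bool.
rewrite compat_or !compat_push; congr (_ && _); apply: (congr1 (compat _)).
  by apply/ffunP=> -[[c|c]|c]; rewrite !ffunE //= !ffunE.
by apply/ffunP=> -[[c|c]|c]; rewrite !ffunE //= !ffunE.
Qed.

Lemma sum_ev t (s : scheme t) (a : ann s) (G : graph) :
  \sum_(x : {ffun ctx t -> G}) ev a x =
  #|[set f : {ffun var s -> G} | compat (constr a) f]|.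
Proof.
rewrite -sum1dep_card [RHS]big_mkcond [RHS]big_fjoin; apply: eq_bigr => x _.
by apply: eq_bigr => b _; case: compat.
Qed.

Lemma constr_clique t (s : scheme t) (a : ann s) b u v :
  constr a b u v -> clique u v.
Proof.
have mono (A B : finType) (f : A -> B) (r r' : rel A) :
    (forall x y, r x y -> r' x y) -> forall x y, push f r x y -> push f r' x y.
  move=> rr x y /pushP[z [w [<- <- h]]]; apply/pushP; exists z, w.
  by split=> //; apply: rr.
rewrite /clique; elim: s a u v => [|p s IH|s1 IH1 s2 IH2] //= a u v /orP[] h;
  apply/orP.
- by left; apply: mono h.
- by right; apply: mono h => x y; apply: IH.
- by left; apply: mono h => x y; apply: IH1.
- by right; apply: mono h => x y; apply: IH2.
Qed.

Lemma clique_refl t (s : scheme t) (u v : var s) : clique u v -> clique u u.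
Proof.
have h (A B : finType) (f : A -> B) (r : rel A) :
    (forall x y, r x y -> r x x) -> forall x y, push f r x y -> push f r x x.
  move=> rr x y /pushP[z [w [<- _ h]]]; apply/pushP; exists z, z.
  by split=> //; apply: rr h.
rewrite /clique; elim: s u v => [|p s IH|s1 IH1 s2 IH2] //= u v /orP[] c; apply/orP.
- by left; apply: h c.
- by right; apply: h c.
- by left; apply: h c.
- by right; apply: h c.
Qed.

(** * Quotients by equality constraints: from schemes to graphs *)

Section Quotient.
Variables (t : nat) (s : scheme t) (a : ann s).

Definition glued : rel (var s) :=
  fun u v => constr a false u v || constr a false v u.

Lemma glued_sym : connect_sym glued.
Proof. by apply: sym_connect_sym => u v; rewrite /glued orbC. Qed.

(** The classes generated by the equality constraints, each represented by its canonical root. *)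
Definition quo_vertex : finType := {u : var s | fingraph.root glued u == u}.

Definition quo (u : var s) : quo_vertex :=
  exist (fun u => fingraph.root glued u == u) (fingraph.root glued u)
    (introT eqP (root_root glued_sym u)).

Lemma quo_eq u v : (quo u == quo v) = connect glued u v.
Proof. by rewrite -(root_connect glued_sym) -val_eqE. Qed.

Lemma quo_val m : quo (val m) = m.
Proof. by apply: val_inj; apply/eqP: (valP m). Qed.

Definition quo_edge : rel quo_vertex := fun m n =>
  [exists u, exists v, [&& quo u == m, quo v == n &
     constr a true u v || constr a true v u]].

Lemma quo_edgeP m n : reflect (exists u v, [/\ quo u = m, quo v = n &
     constr a true u v || constr a true v u]) (quo_edge m n).
Proof.
apply: (iffP existsP) => [[u /existsP[v /and3P[/eqP um /eqP vn c]]]|].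
  by exists u, v.
by move=> [u [v [<- <- c]]]; exists u; apply/existsP; exists v; rewrite !eqxx.
Qed.

Lemma quo_edge_sym : symmetric quo_edge.
Proof.
suff h m n : quo_edge m n -> quo_edge n m by move=> m n; apply/idP/idP; apply: h.
case/quo_edgeP=> u [v [<- <- c]]; apply/quo_edgeP; exists v, u.
by rewrite orbC c.
Qed.

Definition quo_graph : graph := Graph quo_edge_sym.

(** Constraints of both kinds run along edges of the clique graph ([constr_clique]), so the classes
    are connected and can serve as branch sets. *)
Lemma quo_minor : minor quo_graph (scheme_graph s).
Proof.
exists (fun m : quo_graph => [set v : scheme_graph s | quo v == m]); split.
- by move=> m; apply/set0Pn; exists (val m); rewrite inE quo_val.
- move=> m u v; rewrite !inE => /eqP um /eqP vm.
  have /connectP[p] : connect glued u v by rewrite -quo_eq um vm.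
  elim: p u um => [|z p IH] u um /= => [_ ->|/andP[uz pz] ev]; first exact: connect0.
  have zm : quo z = m.
    by rewrite -um; apply/esym/eqP; rewrite quo_eq connect1.
  apply: connect_trans (IH _ zm pz ev); apply: connect1.
  rewrite /= !inE um zm !eqxx /=.
  case/orP: uz => /constr_clique //; by rewrite (clique_sym u).
- move=> m n mn; rewrite -setI_eq0; apply/eqP/setP=> v; rewrite !inE.
  by apply/negP=> /andP[/eqP -> ]; apply/negP.
- move=> m n /quo_edgeP[u [v [um vn c]]].
  have uv : clique u v.
    by case/orP: c => /constr_clique //; rewrite (clique_sym u).
  (* An edge constraint inside one class gives a loop of the quotient; [clique_refl] supplies the
     loop it comes from. *)
  have [mn|mn] := eqVneq m n.
    by exists u, u; rewrite !inE -mn um; split=> //; apply: clique_refl uv.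
  exists u, v; rewrite !inE um vn !eqxx; split=> // e.
  by rewrite e eqxx in mn.
Qed.

(** A labelling that meets the equality constraints is constant on classes, hence factors uniquely
    through [quo]; the edge constraints then say that the factor is a homomorphism. *)
Lemma hom_quo (G : graph) :
  Defs.hom quo_graph G = \sum_(x : {ffun ctx t -> G}) ev a x.
Proof.
rewrite sum_ev.
pose lift (h : {ffun quo_graph -> G}) : {ffun var s -> G} := [ffun v => h (quo v)].
have li : injective lift.
  move=> h k /ffunP e; apply/ffunP=> m; have := e (val m).
  by rewrite !ffunE quo_val.
rewrite /Defs.hom -(card_imset _ li); congr #|pred_of_set _|; apply/setP=> f; rewrite inE.
apply/imsetP/compatP => [[h]|fs].
  rewrite inE => /forallP hh -> u v; rewrite !ffunE; split=> c.
    have /forallP/(_ (quo v))/implyP := hh (quo u); apply.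
    by apply/quo_edgeP; exists u, v; rewrite c.
  by congr (h _); apply/eqP; rewrite quo_eq connect1 // /glued c.
have fq u v : connect glued u v -> f u = f v.
  case/connectP=> p + ->; elim: p u => [|z p IH] u //= /andP[uz /IH <-].
  by case/orP: uz => c; [have [_] := fs u z | have [_] := fs z u] => /(_ c).
exists [ffun m => f (val m)]; last first.
  apply/ffunP=> v; rewrite !ffunE; apply: fq.
  by rewrite -quo_eq quo_val.
rewrite inE; apply/forallP=> m; apply/forallP=> n; apply/implyP.
case/quo_edgeP=> u [v [<- <- c]]; rewrite !ffunE.
have -> : f (val (quo u)) = f u by apply: fq; rewrite -quo_eq quo_val.
have -> : f (val (quo v)) = f v by apply: fq; rewrite -quo_eq quo_val.
case/orP: c => c; first by have [/(_ c)] := fs u v.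
by rewrite edge_sym; have [/(_ c)] := fs v u.
Qed.

End Quotient.

(** * Constraints read off from branch sets: from graphs to schemes *)

Definition label_constr (F : graph) (b : bool) (o o' : option F) : bool :=
  match o, o' with
  | Some m, Some n => if b then edge m n else m == n
  | _, _ => false
  end.

(** [lam] sends a vertex to the branch set containing it, [None] meaning none. Clique edges within a
    branch set become equality constraints, those between branch sets of adjacent vertices become
    edge constraints. *)
Fixpoint label_ann (F : graph) t (s : scheme t) : (var s -> option F) -> ann s :=
  match s with
  | Leaf => fun _ => tt
  | Ren p s1 => fun lam =>
      (fun b c d => label_constr b (lam (inl c)) (lam (inl d)),
       label_ann (s := s1) (fun v => lam (ren_var p v)))
  | Ser s1 s2 => fun lam =>
      (label_ann (s := s1) (fun v => lam (ser_var1 s2 v)),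
       label_ann (s := s2) (fun v => lam (ser_var2 s1 v)))
  end.

Lemma constr_label (F : graph) t (s : scheme t) (lam : var s -> option F) b u v :
  constr (label_ann lam) b u v = clique u v && label_constr b (lam u) (lam v).
Proof.
have h (A B : finType) (i : A -> B) (r r' : rel A) (l : rel B) x y :
    (forall x y, r x y = r' x y && l (i x) (i y)) ->
    push i r x y = push i r' x y && l x y.
  move=> rr; apply/pushP/andP => [[z [w [<- <- ]]]|[/pushP[z [w [<- <- c]]] lc]].
    by rewrite rr => /andP[? ?]; split=> //; apply/pushP; exists z, w.
  by exists z, w; rewrite rr c lc.
rewrite /clique; elim: s lam u v => [|p s IH|s1 IH1 s2 IH2] //= lam u v.
- rewrite (h _ _ _ _ (fun _ _ => true) (fun u v => label_constr b (lam u) (lam v))) //.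
  rewrite [X in _ || X](h _ _ _ _ (constr (full_ann s) true)
    (fun u v => label_constr b (lam u) (lam v))) -?andb_orl // => x y.
  exact: IH.
- rewrite (h _ _ _ _ (constr (full_ann s1) true)
    (fun u v => label_constr b (lam u) (lam v))) => [|x y]; last exact: IH1.
  rewrite [X in _ || X](h _ _ _ _ (constr (full_ann s2) true)
    (fun u v => label_constr b (lam u) (lam v))) -?andb_orl // => x y.
  exact: IH2.
Qed.

(* [c n] counts the images of the vertices of the scheme graph that belong to no
   branch set. *)
Lemma hom_minor_ev (F : graph) t (s : scheme t) :
  minor F (scheme_graph s) ->
  exists (a : ann s) (c : nat -> nat), (forall n, 0 < n -> 0 < c n) /\
    forall G : graph, Defs.hom F G * c #|G| = \sum_(x : {ffun ctx t -> G}) ev a x.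
Proof.
move=> [phi [ne con dis ed]].
pose lam (v : var s) := [pick m | v \in phi m].
have lamP v m : (v \in phi m) = (lam v == Some m).
  rewrite /lam; case: pickP => [n vn|/(_ m) ->] //.
  apply/idP/eqP => [vm|[<- //]]; congr Some; apply/eqP/negPn/negP=> /dis.
  by rewrite -setI_eq0 => /eqP/setP/(_ v); rewrite !inE vn vm.
(* A power of [n], written as the product that [card_family] produces. *)
pose c n := foldr muln 1 [seq (if lam v is Some _ then 1 else n) | v : var s].
exists (label_ann lam), c; split.
  move=> n n0; rewrite /c /image_mem; elim: (enum_mem _) => //= v r IH.
  by rewrite muln_gt0 IH andbT; case: (lam v).
move=> G; rewrite sum_ev -sum1dep_card.
have rep m : {v | v \in phi m} by apply/sigW/set0Pn.
pose rho (f : {ffun var s -> G}) : {ffun F -> G} := [ffun m => f (sval (rep m))].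
have cst (f : {ffun var s -> G}) : compat (constr (label_ann lam)) f ->
    forall m u v, u \in phi m -> v \in phi m -> f u = f v.
  move/compatP=> fs m u v um vm; have /connectP[p] := con m _ _ um vm.
  elim: p u {um vm} => [|z p IH] u /=; first by move=> _ ->.
  case/andP=> /and3P[um zm uz] pz e; rewrite -(IH _ pz e).
  have [_] := fs u z; apply; rewrite constr_label.
  by apply/andP; split=> //; move: um zm; rewrite !lamP => /eqP -> /eqP -> /=.
(* The compatible labellings above a homomorphism [h] are prescribed on the branch sets and
   arbitrary elsewhere. *)
have repP f h : compat (constr (label_ann lam)) f && (rho f == h) =
    is_hom h && (f \in family (fun v => if lam v is Some m then pred1 (h m)
      else predT)).
  apply/andP/andP=> [[fs /eqP <-]|[hh /familyP fh]].
    split.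
      apply/forallP=> m; apply/forallP=> n; apply/implyP=> mn; rewrite !ffunE.
      have [u [v [um vn uv _]]] := ed _ _ mn.
      rewrite (cst _ fs m (sval (rep m)) u) ?(svalP (rep m)) //.
      rewrite (cst _ fs n (sval (rep n)) v) ?(svalP (rep n)) //.
      have /compatP/(_ u v)[+ _] := fs; apply; rewrite constr_label.
      by apply/andP; split=> //; move: um vn; rewrite !lamP => /eqP -> /eqP -> /=.
    apply/familyP=> v; case e: (lam v) => [m|] //=; rewrite inE !ffunE.
    by apply/eqP/(cst _ fs m); rewrite ?(svalP (rep m)) // lamP e.
  have fl v m : lam v = Some m -> f v = h m.
    by move=> e; have := fh v; rewrite e inE => /eqP.
  split.
    apply/compatP=> u v; rewrite !constr_label; split=> /andP[_];
      case eu: (lam u) => [m|] //; case ev: (lam v) => [n|] //=.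
      rewrite (fl _ _ eu) (fl _ _ ev) => mn.
      by have /forallP/(_ m)/forallP/(_ n)/implyP/(_ mn) := hh.
    by rewrite (fl _ _ eu) (fl _ _ ev) => /eqP ->.
  apply/eqP/ffunP=> m; rewrite !ffunE; apply: fl; apply/eqP; rewrite -lamP.
  exact: svalP (rep m).
rewrite (partition_big rho (fun h => is_hom h)) /=; last first.
  by move=> f fs; have := repP f (rho f); rewrite fs eqxx => /esym/andP[].
rewrite /Defs.hom -sum1dep_card big_distrl /=; apply: eq_bigr => h hh.
rewrite mul1n; under eq_bigl => f do rewrite repP hh.
rewrite sum1_card card_family; congr (foldr _ _ _); apply: eq_map => v.
by case: (lam v) => [m|]; rewrite ?card1.
Qed.

(** * Soundness *)

Import Order.TTheory GRing.Theory Num.Theory.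
Local Open Scope ring_scope.

Lemma sum_delta (R : pzSemiRingType) (I : finType) (i : I) (F : I -> R) :
  \sum_j (j == i)%:R * F j = F i.
Proof.
rewrite (bigD1 i) //= eqxx mul1r big1 ?addr0 // => j /negbTE ->.
by rewrite mul0r.
Qed.

(** An isotropic vector of a semidefinite form lies in its radical: at [s * a] plus the unit vector
    at [q], the form is affine in [s] with slope [2 * L], so nonnegativity forces [L = 0]. *)
Lemma psd_isotropic (R : realFieldType) (P : finType) (K : P -> P -> R)
    (a : P -> R) (q : P) :
  (forall p r, K p r = K r p) ->
  (forall w : P -> R, 0 <= \sum_p \sum_r w p * w r * K p r) ->
  \sum_p \sum_r a p * a r * K p r = 0 -> \sum_p a p * K p q = 0.
Proof.
move=> sym psd a0; set L := \sum_p _; apply/eqP/negPn/negP=> L0.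
have h s : 0 <= 2 * s * L + K q q.
  have := psd (fun p => s * a p + (p == q)%:R); congr (_ <= _).
  rewrite (eq_bigr (fun p => s * a p * (\sum_r s * a r * K p r + K p q) +
     (p == q)%:R * (\sum_r s * a r * K p r + K p q))); last first.
    move=> p _; rewrite -mulrDl -[K p q in RHS](sum_delta q (fun r => K p r)).
    rewrite -big_split /= mulr_sumr; apply: eq_bigr => r _.
    by rewrite -mulrA; congr (_ * _); rewrite mulrDl.
  rewrite big_split /= sum_delta.
  rewrite (eq_bigr (fun p => s * s * (\sum_r a p * a r * K p r) +
     s * (a p * K p q))); last first.
    move=> p _; rewrite mulrDr; congr (_ + _); last by rewrite mulrA.
    by rewrite !mulr_sumr; apply: eq_bigr => r _; ring.
  rewrite big_split /= -!mulr_sumr a0 -/L.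
  have -> : \sum_r s * a r * K q r = s * L.
    by rewrite mulr_sumr; apply: eq_bigr => r _; rewrite sym mulrA.
  by ring.
(* Here the form would take the value [-1]. *)
have := h (- (K q q + 1) / (2 * L)).
have -> : 2 * (- (K q q + 1) / (2 * L)) * L = - (K q q + 1) by field.
by lra.
Qed.

Definition swap_label (t : nat) (c : ctx t) : ctx t :=
  match c with inl i => inr i | inr i => inl i end.

Lemma swap_labelK t : involutive (@swap_label t).
Proof. by case. Qed.

Definition swap_perm (t : nat) : {perm ctx t} := perm (inv_inj (@swap_labelK t)).

Lemma fjoin_swap t (T : Type) (g g' : {ffun 'I_t -> T}) :
  [ffun c => fjoin g g' (swap_perm t c)] = fjoin g' g.
Proof. by apply/ffunP=> -[i|i]; rewrite !ffunE permE. Qed.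

(** [Z x k] stands for the value of a Lasserre solution at the set of pairs [(x c, k c)]. Ordered
    tuples with repetitions replace sets, and half tuples index the rows of the moment matrix. *)
Record tuple_solution (R : realFieldType) (t : nat) (G H : graph)
    (Z : {ffun ctx t -> G} -> {ffun ctx t -> H} -> R) : Prop := TupleSolution {
  ts_eq : forall x k c d, Z x k != 0 -> (x c == x d) = (k c == k d);
  ts_edge : forall x k c d, Z x k != 0 -> edge (x c) (x d) = edge (k c) (k d);
  ts_row : forall x, \sum_k Z x k = 1;
  ts_col : forall k, \sum_x Z x k = 1;
  ts_perm : forall (p : {perm ctx t}) (x : {ffun ctx t -> G}) (k : {ffun ctx t -> H}),
    Z [ffun c => x (p c)] [ffun c => k (p c)] = Z x k;
  ts_psd : forall w : {ffun 'I_t -> G} * {ffun 'I_t -> H} -> R,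
    0 <= \sum_p \sum_q w p * w q * Z (fjoin p.1 q.1) (fjoin p.2 q.2) }.

Section Soundness.
Variables (R : realFieldType) (t : nat).

Lemma tuple_solution_sym (G H : graph) (Z : {ffun ctx t -> G} -> {ffun ctx t -> H} -> R) :
  tuple_solution Z -> tuple_solution (fun k x => Z x k).
Proof.
case=> eqZ edZ row col prm psd; split=> //.
- by move=> k x c d /eqZ ->.
- by move=> k x c d /edZ ->.
- move=> w; rewrite -[X in 0 <= X](_ : \sum_p \sum_q w (p.2, p.1) * w (q.2, q.1)
     * Z (fjoin p.1 q.1) (fjoin p.2 q.2) = _); first exact: (psd (fun p => w (p.2, p.1))).
  have rx (F : {ffun 'I_t -> G} * {ffun 'I_t -> H} -> R) :
      \sum_p F p = \sum_p F (p.2, p.1).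
    rewrite (reindex (fun p : {ffun 'I_t -> H} * {ffun 'I_t -> G} => (p.2, p.1))) //.
    by exists (fun p => (p.2, p.1)) => -[].
  rewrite rx; apply: eq_bigr => p _; rewrite rx; apply: eq_bigr => q _ /=.
  by rewrite -!surjective_pairing.
Qed.

(** By [ts_eq], two equal halves on one side force two equal halves on the other, so a row sum is
    concentrated on the diagonal. This evaluates the two norms in [intertwine]. *)
Lemma ts_diag (G H : graph) (Z : {ffun ctx t -> G} -> {ffun ctx t -> H} -> R)
    (sol : tuple_solution Z) g g' :
  \sum_h Z (fjoin g g') (fjoin h h) = (g == g')%:R.
Proof.
have [<-|gg] := eqVneq g g'.
  rewrite -[RHS](ts_row sol (fjoin g g)) big_fjoin; apply: eq_bigr => h _.
  rewrite (bigD1 h) //= big1 ?addr0 // => h' hh.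
  apply/eqP/negPn/negP=> nz; move/eqP: hh; apply; apply/ffunP=> i.
  have := ts_eq sol (inl i) (inr i) nz; rewrite !ffunE eqxx.
  by move/esym/eqP.
rewrite big1 // => h _; apply/eqP/negPn/negP=> nz; move/eqP: gg; apply.
apply/ffunP=> i; have := ts_eq sol (inl i) (inr i) nz; rewrite !ffunE eqxx.
by move/eqP.
Qed.

Variables (G H : graph) (Z : {ffun ctx t -> G} -> {ffun ctx t -> H} -> R).
Hypothesis sol : tuple_solution Z.

Lemma ts_compat cs (x : {ffun ctx t -> G}) (k : {ffun ctx t -> H}) :
  Z x k != 0 -> compat cs x = compat cs k.
Proof.
move=> nz; apply: eq_forallb => c; apply: eq_forallb => d.
by rewrite (ts_edge sol c d nz) (ts_eq sol c d nz).
Qed.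

Lemma ts_swap g g' h h' : Z (fjoin g g') (fjoin h h') = Z (fjoin g' g) (fjoin h' h).
Proof. by rewrite -(ts_perm sol (swap_perm t)) !fjoin_swap. Qed.

Lemma big_pair_sep (A B : finType) (F : A * B -> R) :
  \sum_p F p = \sum_a \sum_b F (a, b).
Proof. by rewrite pair_bigA; apply: eq_bigr => -[]. Qed.

(* The squared seminorm of the difference of the two sides, summed over
   [g] and [h'], is [|M|^2 - 2 <Phi M, N> + |N|^2 = 0]. *)
Lemma intertwine (M : {ffun ctx t -> G} -> R) (N : {ffun ctx t -> H} -> R) :
  (forall k, \sum_x Z x k * M x = N k) -> (forall x, \sum_k Z x k * N k = M x) ->
  forall g h' g2 h2,
    \sum_p M (fjoin g p) * Z (fjoin p g2) (fjoin h' h2) =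
    \sum_q N (fjoin q h') * Z (fjoin g g2) (fjoin q h2).
Proof.
move=> MN NM.
pose K (p q : {ffun 'I_t -> G} * {ffun 'I_t -> H}) := Z (fjoin p.1 q.1) (fjoin p.2 q.2).
(* The coefficients, with respect to the Gram vectors of [K], of the defect at [(g, h')]. *)
pose d g h' (p : {ffun 'I_t -> G} * {ffun 'I_t -> H}) :=
  (p.2 == h')%:R * M (fjoin g p.1) - (p.1 == g)%:R * N (fjoin p.2 h').
have dE g h' (F : {ffun 'I_t -> G} * {ffun 'I_t -> H} -> R) :
    \sum_p d g h' p * F p = \sum_p M (fjoin g p) * F (p, h') - \sum_q N (fjoin q h') * F (g, q).
  under eq_bigr => p _ do rewrite mulrBl.
  rewrite sumrB; congr (_ - _).
    rewrite big_pair_sep; apply: eq_bigr => p _ /=.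
    by under eq_bigr => h _ do rewrite -mulrA; rewrite sum_delta.
  rewrite big_pair_sep exchange_big /=; apply: eq_bigr => q _ /=.
  by under eq_bigr => h _ do rewrite -mulrA; rewrite sum_delta.
have Ksym p q : K p q = K q p by apply: ts_swap.
have psd := ts_psd sol.
pose Q g h' := \sum_p \sum_q d g h' p * d g h' q * K p q.
have QE g h' : Q g h' =
    \sum_p \sum_p' M (fjoin g p) * M (fjoin g p') * Z (fjoin p p') (fjoin h' h')
    - 2 * (\sum_p \sum_q M (fjoin g p) * N (fjoin q h') * Z (fjoin g p) (fjoin q h'))
    + \sum_q \sum_q' N (fjoin q h') * N (fjoin q' h') * Z (fjoin g g) (fjoin q q').
  rewrite /Q; under eq_bigr => p _ do (under eq_bigr => q _ do rewrite -mulrA);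
    under eq_bigr => p _ do rewrite -mulr_sumr dE.
  rewrite dE /K /=.
  have e1 : \sum_p M (fjoin g p) * (\sum_p0 M (fjoin g p0) * Z (fjoin p p0) (fjoin h' h') -
       \sum_q N (fjoin q h') * Z (fjoin p g) (fjoin h' q)) =
     \sum_p \sum_p' M (fjoin g p) * M (fjoin g p') * Z (fjoin p p') (fjoin h' h') -
     \sum_p \sum_q M (fjoin g p) * N (fjoin q h') * Z (fjoin g p) (fjoin q h').
    rewrite -sumrB; apply: eq_bigr => p _; rewrite mulrBr !mulr_sumr; congr (_ - _);
      apply: eq_bigr => q _; first by rewrite mulrA.
    by rewrite mulrA ts_swap.
  have e2 : \sum_q N (fjoin q h') * (\sum_p M (fjoin g p) * Z (fjoin g p) (fjoin q h') -
       \sum_q0 N (fjoin q0 h') * Z (fjoin g g) (fjoin q q0)) =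
     \sum_p \sum_q M (fjoin g p) * N (fjoin q h') * Z (fjoin g p) (fjoin q h') -
     \sum_q \sum_q' N (fjoin q h') * N (fjoin q' h') * Z (fjoin g g) (fjoin q q').
    rewrite [X in _ = X - _]exchange_big -sumrB; apply: eq_bigr => p _.
    rewrite mulrBr !mulr_sumr; congr (_ - _);
      apply: eq_bigr => q _; rewrite mulrA // [N _ * M _]mulrC //.
  by rewrite e1 e2; ring.
have T1 : \sum_g \sum_h'
    (\sum_p \sum_q M (fjoin g p) * N (fjoin q h') * Z (fjoin g p) (fjoin q h'))
    = \sum_x \sum_k M x * N k * Z x k.
  rewrite big_fjoin; apply: eq_bigr => g _; rewrite exchange_big; apply: eq_bigr => p _.
  by rewrite big_fjoin exchange_big.
have TM : \sum_x \sum_k M x * N k * Z x k = \sum_x M x * M x.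
  apply: eq_bigr => x _; rewrite -[X in _ = _ * X]NM mulr_sumr.
  by apply: eq_bigr => k _; rewrite -mulrA [N k * _]mulrC.
have TN : \sum_x \sum_k M x * N k * Z x k = \sum_k N k * N k.
  rewrite exchange_big; apply: eq_bigr => k _; rewrite -[X in _ = _ * X]MN mulr_sumr.
  by apply: eq_bigr => x _; ring.
(* Summing over [h'] first turns the kernel into the Kronecker delta of [ts_diag]. *)
have A1 : \sum_g \sum_h'
    (\sum_p \sum_p' M (fjoin g p) * M (fjoin g p') * Z (fjoin p p') (fjoin h' h'))
    = \sum_x M x * M x.
  rewrite big_fjoin; apply: eq_bigr => g _; rewrite exchange_big; apply: eq_bigr => p _.
  rewrite exchange_big -[RHS](sum_delta p (fun p' => M (fjoin g p) * M (fjoin g p'))).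
  apply: eq_bigr => p' _; rewrite -mulr_sumr (ts_diag sol) eq_sym mulrC.
  by [].
have A2 : \sum_g \sum_h'
    (\sum_q \sum_q' N (fjoin q h') * N (fjoin q' h') * Z (fjoin g g) (fjoin q q'))
    = \sum_k N k * N k.
  rewrite exchange_big big_fjoin [RHS]exchange_big; apply: eq_bigr => h' _.
  rewrite exchange_big; apply: eq_bigr => q _.
  rewrite exchange_big -[RHS](sum_delta q (fun q' => N (fjoin q h') * N (fjoin q' h'))).
  apply: eq_bigr => q' _; rewrite -mulr_sumr mulrC; congr (_ * _).
  by rewrite (ts_diag (tuple_solution_sym sol)) eq_sym.
have Q0 : \sum_g \sum_h' Q g h' = 0.
  under eq_bigr => g _ do (under eq_bigr => h' _ do rewrite QE);
  under eq_bigr => g _ do rewrite big_split sumrB /= -mulr_sumr.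
  by rewrite big_split sumrB /= -mulr_sumr A1 A2 T1 -{1}TM TN; ring.
move=> g h' g2 h2.
have Qgh : Q g h' = 0.
  have Qp g1 h1 : 0 <= Q g1 h1 by apply: psd.
  move/eqP: Q0; rewrite psumr_eq0 => [/allP/(_ g)|g1 _]; last by apply: sumr_ge0.
  rewrite mem_index_enum => /(_ isT)/eqP.
  move/eqP; rewrite psumr_eq0 => [/allP/(_ h')|h1 _ //].
  by rewrite mem_index_enum => /(_ isT)/eqP.
(* A defect of norm zero is orthogonal to every Gram vector, in particular to the one at
   [(g2, h2)]. *)
have := psd_isotropic (g2, h2) Ksym psd Qgh.
by rewrite dE => /eqP; rewrite subr_eq0 => /eqP.
Qed.

(** Both directions are demanded: together they give [|M|^2 = <Z M, N> = |N|^2], on which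
    [intertwine] rests. *)
Definition transported (M : {ffun ctx t -> G} -> R) (N : {ffun ctx t -> H} -> R) :=
  (forall k, \sum_x Z x k * M x = N k) /\ (forall x, \sum_k Z x k * N k = M x).

Lemma big_perm_ctx (X : finType) (p : {perm ctx t}) (F : {ffun ctx t -> X} -> R) :
  \sum_x F x = \sum_(x : {ffun ctx t -> X}) F [ffun c => x (p c)].
Proof.
rewrite (reindex (fun x : {ffun ctx t -> X} => [ffun c => x (p c)])) //.
exists (fun x : {ffun ctx t -> X} => [ffun c => x ((p^-1)%g c)]) => x _;
  by apply/ffunP=> c; rewrite !ffunE ?permK ?permKV.
Qed.

End Soundness.

Lemma transported_sym (R : realFieldType) t (G H : graph)
    (Z : {ffun ctx t -> G} -> {ffun ctx t -> H} -> R) M N :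
  transported Z M N -> transported (fun k x => Z x k) N M.
Proof. by case. Qed.

Section Soundness2.
Variables (R : realFieldType) (t : nat).

Lemma transported_perm (G H : graph)
    (Z : {ffun ctx t -> G} -> {ffun ctx t -> H} -> R) (p : {perm ctx t}) M N :
  tuple_solution Z -> transported Z M N ->
  transported Z (fun x : {ffun ctx t -> G} => M [ffun c => x (p c)])
    (fun k : {ffun ctx t -> H} => N [ffun c => k (p c)]).
Proof.
(* One direction is shown for arbitrary graphs; the other is the same statement for the transposed
   kernel. *)
have half (G1 H1 : graph) (Z1 : {ffun ctx t -> G1} -> {ffun ctx t -> H1} -> R) M1 N1 :
    tuple_solution Z1 -> (forall k, \sum_x Z1 x k * M1 x = N1 k) ->
    forall k : {ffun ctx t -> H1},
      \sum_(x : {ffun ctx t -> G1}) Z1 x k * M1 [ffun c => x (p c)] = N1 [ffun c => k (p c)].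
  move=> sol MN k; rewrite -MN [RHS](big_perm_ctx p); apply: eq_bigr => x _.
  by rewrite (ts_perm sol).
by move=> sol [MN NM]; split; [exact: half | exact: half (tuple_solution_sym sol) NM].
Qed.

Lemma transported_compat (G H : graph)
    (Z : {ffun ctx t -> G} -> {ffun ctx t -> H} -> R) cs M N :
  tuple_solution Z -> transported Z M N ->
  transported Z (fun x => (compat cs x)%:R * M x) (fun k => (compat cs k)%:R * N k).
Proof.
have half (G1 H1 : graph) (Z1 : {ffun ctx t -> G1} -> {ffun ctx t -> H1} -> R) M1 N1 :
    tuple_solution Z1 -> (forall k, \sum_x Z1 x k * M1 x = N1 k) ->
    forall k, \sum_x Z1 x k * ((compat cs x)%:R * M1 x) = (compat cs k)%:R * N1 k.
  move=> sol MN k; rewrite -MN mulr_sumr; apply: eq_bigr => x _.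
  have [->|nz] := eqVneq (Z1 x k) 0; first by rewrite !(mul0r, mulr0).
  by rewrite (ts_compat sol cs nz) mulrCA.
by move=> sol [MN NM]; split; [exact: half | exact: half (tuple_solution_sym sol) NM].
Qed.

Lemma transported_one (G H : graph)
    (Z : {ffun ctx t -> G} -> {ffun ctx t -> H} -> R) :
  tuple_solution Z -> transported Z (fun=> 1) (fun=> 1).
Proof.
move=> sol; split=> x; under eq_bigr => y _ do rewrite mulr1;
  by rewrite ?(ts_row sol) ?(ts_col sol).
Qed.

Definition series (X : finType) (M M' : {ffun ctx t -> X} -> R) (x : {ffun ctx t -> X}) : R :=
  \sum_(y : {ffun 'I_t -> X}) M (fjoin (lpart x) y) * M' (fjoin y (rpart x)).

(** [intertwine] carries the first factor from the [G] side of the kernel to the [H] side; what is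
    left is the image of the second factor under the kernel. *)
Lemma transported_series (G H : graph)
    (Z : {ffun ctx t -> G} -> {ffun ctx t -> H} -> R) M M' N N' :
  tuple_solution Z -> transported Z M N -> transported Z M' N' ->
  transported Z (series M M') (series N N').
Proof.
have half (G1 H1 : graph) (Z1 : {ffun ctx t -> G1} -> {ffun ctx t -> H1} -> R)
    M1 M1' N1 N1' :
    tuple_solution Z1 -> transported Z1 M1 N1 -> transported Z1 M1' N1' ->
    forall k, \sum_x Z1 x k * series M1 M1' x = series N1 N1' k.
  move=> sol MN [MN' _] k; rewrite -(fjoin_parts k).
  move: (lpart k) (rpart k) => h h''; rewrite big_fjoin.
  (* [intertwine] contracts the second half of its tensor on the [G] side, whereas the sum here runs
     over the first half of [M1]; hence the swap. *)
  have [T1 T2] := transported_perm (swap_perm t) sol MN.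
  have int := intertwine sol T1 T2.
  transitivity (\sum_g'' \sum_y M1' (fjoin y g'') *
      \sum_g M1 (fjoin g y) * Z1 (fjoin g g'') (fjoin h h'')).
    rewrite exchange_big; apply: eq_bigr => g'' _; rewrite /series.
    under eq_bigr => g _ do rewrite fjoinK1 fjoinK2 mulr_sumr.
    rewrite exchange_big; apply: eq_bigr => y _; rewrite mulr_sumr.
    by apply: eq_bigr => g _; ring.
  transitivity (\sum_g'' \sum_y M1' (fjoin y g'') *
      \sum_h1 N1 (fjoin h h1) * Z1 (fjoin y g'') (fjoin h1 h'')).
    apply: eq_bigr => g'' _; apply: eq_bigr => y _; congr (_ * _).
    have := int y h g'' h''.
    under eq_bigr => g _ do rewrite fjoin_swap.
    by under [in RHS]eq_bigr => g _ do rewrite fjoin_swap.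
  rewrite /series fjoinK1 fjoinK2.
  under eq_bigr => g'' _ do (under eq_bigr => y _ do rewrite mulr_sumr).
  under eq_bigr => g'' _ do rewrite exchange_big.
  rewrite exchange_big; apply: eq_bigr => h1 _; rewrite -MN' mulr_sumr.
  rewrite big_fjoin exchange_big; apply: eq_bigr => y _; apply: eq_bigr => g'' _.
  by ring.
move=> sol MN MN'; split; first exact: half.
exact: half (tuple_solution_sym sol) (transported_sym MN) (transported_sym MN').
Qed.

Lemma transported_ev (G H : graph)
    (Z : {ffun ctx t -> G} -> {ffun ctx t -> H} -> R) (s : scheme t) (a : ann s) :
  tuple_solution Z -> transported Z (fun x => (ev a x)%:R) (fun k => (ev a k)%:R).
Proof.
move=> sol; have ext M M' N N' : (forall x, M x = M' x) -> (forall k, N k = N' k) ->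
    transported Z M N -> transported Z M' N'.
  move=> MM NN [h1 h2]; split=> [k|x]; [rewrite -NN -h1 | rewrite -MM -h2];
    by apply: eq_bigr => ? _; rewrite ?MM ?NN.
elim: s a => [|p s IH|s1 IH1 s2 IH2] a.
- by apply: ext (transported_one sol) => x; rewrite ev_leaf.
- apply: ext (transported_compat a.1 sol (transported_perm p sol (IH a.2))) => x;
    by rewrite ev_ren natrM.
- apply: ext (transported_series sol (IH1 a.1) (IH2 a.2)) => x;
    by rewrite ev_ser natr_sum; apply: eq_bigr => y _; rewrite natrM.
Qed.

Lemma transported_sum (G H : graph)
    (Z : {ffun ctx t -> G} -> {ffun ctx t -> H} -> R) M N :
  tuple_solution Z -> transported Z M N -> \sum_x M x = \sum_k N k.
Proof.
move=> sol [MN _]; under [RHS]eq_bigr => k _ do rewrite -MN.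
rewrite exchange_big; apply: eq_bigr => x _; rewrite -mulr_suml.
by rewrite (ts_row sol) mul1r.
Qed.

Theorem tuple_solution_sum_ev (G H : graph)
    (Z : {ffun ctx t -> G} -> {ffun ctx t -> H} -> R) (s : scheme t) (a : ann s) :
  tuple_solution Z ->
  (\sum_(x : {ffun ctx t -> G}) ev a x = \sum_(k : {ffun ctx t -> H}) ev a k)%N.
Proof.
move=> sol; apply/eqP; rewrite -(eqr_nat R) !natr_sum; apply/eqP.
exact: transported_sum sol (transported_ev a sol).
Qed.

End Soundness2.

(** * From Lasserre solutions to tuple solutions *)

Lemma psd_congr (R : realFieldType) (P Q : finType) (K : P -> P -> R)
    (c : Q -> P -> R) :
  (forall w : P -> R, 0 <= \sum_p \sum_r w p * w r * K p r) ->
  forall w : Q -> R,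
    0 <= \sum_p \sum_r w p * w r * (\sum_a \sum_b c p a * c r b * K a b).
Proof.
move=> psd w; have := psd (fun a => \sum_p w p * c p a); congr (_ <= _).
transitivity (\sum_a \sum_p \sum_r \sum_b w p * c p a * (w r * c r b) * K a b).
  apply: eq_bigr => a _; under eq_bigr => b _ do rewrite mulr_suml mulr_suml.
  rewrite exchange_big; apply: eq_bigr => p _.
  under eq_bigr => b _ do rewrite mulr_sumr mulr_suml.
  by rewrite exchange_big.
rewrite exchange_big; apply: eq_bigr => p _; rewrite exchange_big.
apply: eq_bigr => r _; rewrite mulr_sumr; apply: eq_bigr => a _.
by rewrite mulr_sumr; apply: eq_bigr => b _; ring.
Qed.

Definition upd (I : finType) (T : Type) (x : {ffun I -> T}) i v : {ffun I -> T} :=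
  [ffun j => if j == i then v else x j].

(** Exchanging the coordinate [i] of [x] with [v] is an involution on the pairs [(x, v)]. *)
Lemma sum_upd (R : pzRingType) (I T : finType) (F : {ffun I -> T} -> R) i :
  \sum_x \sum_v F (upd x i v) = #|T|%:R * \sum_x F x.
Proof.
rewrite pair_bigA.
rewrite (reindex_inj (h := fun p : {ffun I -> T} * T => (upd p.1 i p.2, p.1 i))).
  rewrite -(pair_bigA _ (fun x v => F (upd (upd x i v) i (x i)))) mulr_sumr /=.
  apply: eq_bigr => x _; rewrite (eq_bigr (fun=> F x)) => [|v _]; last first.
    congr (F _); apply/ffunP=> j; rewrite !ffunE.
    by case: eqP => // ->.
  by rewrite sumr_const mulr_natl.
apply: (can_inj (g := fun p : {ffun I -> T} * T => (upd p.1 i p.2, p.1 i))).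
case=> x v; congr pair; last by rewrite /= ffunE eqxx.
by apply/ffunP=> j; rewrite !ffunE; case: eqP => // ->.
Qed.

Lemma moment_quad (R : realType) (X : finType) t (y : {set X} -> R)
    (x : 'cV[R]_#|{: set_le X t}|) :
  (x^T *m moment_matrix t y *m x) 0 0 =
  \sum_(I : set_le X t) \sum_(J : set_le X t)
    x (enum_rank I) 0 * x (enum_rank J) 0 * y (val I :|: val J).
Proof.
rewrite mxE (reindex (@enum_val (set_le X t) predT)) /=; last first.
  by apply: onW_bij; apply: enum_val_bij.
rewrite [RHS]exchange_big (reindex (@enum_val (set_le X t) predT)) /=; last first.
  by apply: onW_bij; apply: enum_val_bij.
apply: eq_bigr => j _; rewrite mxE mulr_suml.
by apply: eq_bigr => i _; rewrite !mxE !enum_valK mulrAC.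
Qed.

Section FromLasserre.
Variables (R : realType) (t : nat) (G H : graph) (y : {set G * H} -> R).
Hypotheses (t0 : (0 < t)%N) (sol : lasserre_solution t y).

Lemma lasserre_psd (w : set_le (G * H)%type t -> R) :
  0 <= \sum_I \sum_J w I * w J * y (val I :|: val J).
Proof.
case: sol => [[_ psd] _ _ _ _].
have := psd (\col_i w (enum_val i)); rewrite moment_quad; congr (_ <= _).
by apply: eq_bigr => I _; apply: eq_bigr => J _; rewrite !mxE !enum_rankK.
Qed.

(* The defect [sum_a v_(K + e a) - v_K] of the Gram vectors has norm zero. *)
Lemma lasserre_marginal (T : finType) (e : T -> G * H) :
  (forall a b (I : {set G * H}), a != b -> e a \in I -> e b \in I -> ~ partial_iso I) ->
  (forall I : {set G * H}, (#|I| <= 2 * t - 2)%N ->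
     \sum_a y (I :|: [set e a]) = y I) ->
  forall I : {set G * H}, (#|I| <= 2 * t - 1)%N ->
    \sum_a y (I :|: [set e a]) = y I.
Proof.
move=> sep marg I leI; have [_ _ _ y0 _] := sol.
(* [I] is split into [J] of size at most [t] and [K] of size at most [t - 1], so that [K] with one
   more pair still indexes a row of the moment matrix. *)
have szJ : (#|[set x in take t (enum I)]| <= t)%N.
  by rewrite cardsE; apply: leq_trans (card_size _) _; rewrite size_take; case: ltnP.
have szK : (#|[set x in drop t (enum I)]| <= t - 1)%N.
  rewrite cardsE; apply: leq_trans (card_size _) _; rewrite size_drop -cardE.
  by clear -leI t0; lia.
have IE : I = [set x in drop t (enum I)] :|: [set x in take t (enum I)].
  apply/setP=> x; rewrite !inE -mem_cat -[in LHS]mem_enum.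
  by rewrite -{1}(cat_take_drop t (enum I)) !mem_cat orbC.
move: szJ szK IE; move: [set x in take _ _] [set x in drop _ _] => J K szJ szK IE.
have szKe a : (#|K :|: [set e a]| <= t)%N.
  by rewrite (leq_trans (leq_card_setU _ _)) // cards1 addn1 -(prednK t0) ltnS -subn1.
have szK' : (#|K| <= t)%N by apply: leq_trans szK _; apply: leq_subr.
pose S a : set_le (G * H)%type t := exist _ (K :|: [set e a]) (szKe a).
pose S0 : set_le (G * H)%type t := exist _ K szK'.
pose d (L : set_le (G * H)%type t) : R := \sum_a (L == S a)%:R - (L == S0)%:R.
have dE F : \sum_L d L * F L = \sum_a F (S a) - F S0.
  under eq_bigr => L _ do rewrite mulrBl mulr_suml.
  rewrite sumrB sum_delta exchange_big; congr (_ - _); apply: eq_bigr => a _.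
  exact: sum_delta.
have margK : \sum_a y (K :|: [set e a]) = y K.
  apply: marg; apply: leq_trans szK _.
  by clear -t0; lia.
have sym (L M : set_le (G * H)%type t) : y (val L :|: val M) = y (val M :|: val L).
  by rewrite setUC.
have := psd_isotropic (exist (fun J : {set G * H} => #|J| <= t)%N J szJ) sym lasserre_psd (a := d).
rewrite dE /= => h; apply/eqP; rewrite -subr_eq0 IE; apply/eqP.
rewrite -{}[RHS]h; first by congr (_ - _); apply: eq_bigr => a _; rewrite setUAC.
under eq_bigr => L _ do (under eq_bigr => M _ do rewrite -mulrA);
  under eq_bigr => L _ do rewrite -mulr_sumr dE.
rewrite dE /= setUid.
have -> : \sum_a y (K :|: (K :|: [set e a])) - y K = 0.
  apply/eqP; rewrite subr_eq0 -[X in _ == X]margK; apply/eqP/eq_bigr => a _.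
  by rewrite setUA setUid.
rewrite subr0 big1 // => a _.
(* Only [b = a] survives: any other union contains both [e a] and [e b] and is not a partial
   isomorphism. *)
rewrite (bigD1 a) //= setUid [X in _ + X - _]big1 => [|b ba].
  by rewrite addr0 setUAC setUid subrr.
apply: y0; last first.
  by apply: (sep b a) => //; rewrite !inE eqxx ?orbT.
rewrite setUACA setUid (leq_trans (leq_card_setU _ _)) //.
rewrite (leq_trans (leq_add szK (leq_card_setU [set e a] [set e b]))) //.
by rewrite !cards1; clear -t0; lia.
Qed.

(** The marginal constraint discards labels one at a time. The sum still runs over all [2 t]
    coordinates, so a discarded label leaves a factor [#|T|], cancelled at the end. *)
Lemma lasserre_tuple_sum (T : finType) (e : ctx t -> T -> G * H) :
  (forall (I : {set G * H}) c, (#|I| <= 2 * t - 1)%N ->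
    \sum_v y (I :|: [set e c v]) = y I) ->
  \sum_(k : {ffun ctx t -> T}) y [set e c (k c) | c : ctx t] = 1.
Proof.
move=> marg; have [_ _ _ _ y1] := sol.
have step (r : seq (ctx t)) : uniq r ->
    #|T|%:R ^+ size r * \sum_(k : {ffun ctx t -> T}) y [set p in [seq e c (k c) | c <- r]]
    = \sum_(k : {ffun ctx t -> T}) 1.
  elim: r => [|c r IH] /=.
    move=> _; rewrite mul1r; apply: eq_bigr => k _; rewrite -y1; congr y.
  case/andP=> cr ur; rewrite -(IH ur) exprSr -mulrA -(sum_upd _ c); congr (_ * _).
  apply: eq_bigr => k _; rewrite -[RHS](marg _ c); last first.
    rewrite cardsE (leq_trans (card_size _)) // size_map.
    have /card_uniqP : uniq (c :: r) by rewrite /= cr.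
    have := max_card (mem (c :: r)); rewrite card_sum !card_ord => + e1.
    by rewrite e1 /= => h; clear -h; lia.
  apply: eq_bigr => v _; congr y; apply/setP=> p; rewrite !inE orbC.
  rewrite ffunE eqxx; congr (_ || _).
  have /eq_in_map -> // : {in r, (fun c0 => e c0 (upd k c v c0)) =1 (fun c0 => e c0 (k c0))}.
  by move=> c0 c0r; rewrite ffunE; case: eqP cr => // <-; rewrite c0r.
(* An empty [T] would make the marginal of the empty set [0] instead of [1]. *)
have nz : (#|T|%:R : R) != 0.
  have c : ctx t := inl (Ordinal t0).
  apply/eqP=> T0; have := marg set0 c; rewrite cards0 y1 => /(_ (leq0n _)).
  rewrite big1 => [/eqP|v _]; first by rewrite eq_sym oner_eq0.
  by move/eqP: T0; rewrite pnatr_eq0 => /eqP/card0_eq/(_ v).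
have := step _ (enum_uniq (ctx t)).
rewrite [RHS]sumr_const card_ffun -cardE natrX -[RHS]mulr1.
move/mulfI => /(_ (expf_neq0 _ nz)) <-; apply: eq_bigr => k _; congr y.
apply/setP=> p; rewrite inE; apply/imsetP/mapP => -[c _ ->]; exists c => //.
by rewrite mem_enum.
Qed.

Theorem lasserre_tuple_solution :
  tuple_solution (fun (x : {ffun ctx t -> G}) (k : {ffun ctx t -> H}) =>
    y [set (x c, k c) | c : ctx t]).
Proof.
have [_ row col y0 _] := sol.
have card_le (x : {ffun ctx t -> G}) (k : {ffun ctx t -> H}) :
    (#|[set (x c, k c) | c : ctx t]| <= 2 * t)%N.
  by rewrite (leq_trans (leq_imset_card _ _)) // card_sum !card_ord mul2n addnn.
have iso (x : {ffun ctx t -> G}) (k : {ffun ctx t -> H}) :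
    y [set (x c, k c) | c : ctx t] != 0 -> partial_iso [set (x c, k c) | c : ctx t].
  move=> nz; apply: contrapT => npi; move/eqP: nz; apply.
  by apply: y0.
have mem (x : {ffun ctx t -> G}) (k : {ffun ctx t -> H}) c :
    (x c, k c) \in [set (x c, k c) | c : ctx t] by apply: imset_f.
split.
- move=> x k c d /iso pi; have [[h1 h2] _] := pi _ _ (mem x k c) (mem x k d).
  by apply/eqP/eqP.
- move=> x k c d /iso pi; have [_ [h1 h2]] := pi _ _ (mem x k c) (mem x k d).
  by apply/idP/idP.
- move=> x; apply: (lasserre_tuple_sum (e := fun c v => (x c, v))) => I c.
  apply: lasserre_marginal => [a b J ab aJ bJ /(_ _ _ aJ bJ)[[+ _] _]|J].
    by move=> /(_ erefl)/= eab; rewrite eab eqxx in ab.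
  by apply: row.
- move=> k; apply: (lasserre_tuple_sum (e := fun c v => (v, k c))) => I c.
  apply: lasserre_marginal => [a b J ab aJ bJ /(_ _ _ aJ bJ)[[_ +] _]|J].
    by move=> /(_ erefl)/= eab; rewrite eab eqxx in ab.
  by apply: col.
- move=> p x k; congr y; apply/setP=> q; apply/imsetP/imsetP => -[c _ ->].
    by exists (p c); rewrite ?ffunE.
  by exists (p^-1%g c); rewrite // !ffunE permKV.
- move=> w.
  have szS (p : {ffun 'I_t -> G} * {ffun 'I_t -> H}) :
      (#|[set (p.1 i, p.2 i) | i : 'I_t]| <= t)%N.
    by rewrite (leq_trans (leq_imset_card _ _)) // card_ord.
  pose S p : set_le (G * H)%type t :=
    exist (fun J : {set G * H} => #|J| <= t)%N _ (szS p).
  (* Several half tuples can have the same underlying set, so the moment form is pulled back along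
     [S]. *)
  have := psd_congr (fun p L => (L == S p)%:R) lasserre_psd w; congr (_ <= _).
  apply: eq_bigr => p _; apply: eq_bigr => q _; congr (_ * _).
  under eq_bigr => L _ do (under eq_bigr => M _ do rewrite -mulrA);
    under eq_bigr => L _ do rewrite -mulr_sumr sum_delta.
  rewrite sum_delta /=; congr y; apply/setP=> z.
  rewrite inE; apply/orP/imsetP => [[] /imsetP[i _ ->]|[[i|i] _ ->]].
  + by exists (inl i); rewrite ?ffunE.
  + by exists (inr i); rewrite ?ffunE.
  + by left; apply/imsetP; exists i; rewrite ?ffunE.
  + by right; apply/imsetP; exists i; rewrite ?ffunE.
Qed.

End FromLasserre.

(** * Transport along equal Gram matrices *)

Section Gram.
Variable R : realFieldType.

Lemma row_norm0 n (w : 'rV[R]_n) : w *m w^T = 0 -> w = 0.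
Proof.
move/matrixP/(_ 0 0); rewrite !mxE => /eqP.
rewrite psumr_eq0 => [/allP h|i _]; last by rewrite mxE -expr2 sqr_ge0.
apply/rowP=> i; rewrite mxE; have := h i; rewrite mem_index_enum mxE => /(_ isT).
by rewrite -expr2 sqrf_eq0 => /eqP.
Qed.

(** The index type may be infinite, so vectors outside the current span are adjoined until the
    codimension is used up; a maximal free subfamily is then extracted. *)
Lemma exists_spanning (T : Type) a (u : T -> 'rV[R]_a) :
  exists m (f : 'I_m -> T), row_free (\matrix_i u (f i)) /\
    forall tau, (u tau <= \matrix_i u (f i))%MS.
Proof.
suff [m [f span]] : exists m (f : 'I_m -> T), forall tau, (u tau <= \matrix_i u (f i))%MS.
  pose A := \matrix_i u (f i).
  have AE : rowsub (maxrankfun A) A = \matrix_i u (f (maxrankfun A i)).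
    by apply/row_matrixP=> i; rewrite row_rowsub !rowK.
  exists (\rank A), (fun i => f (maxrankfun A i)); rewrite -AE; split.
    exact: maxrowsub_free.
  by move=> tau; rewrite eq_maxrowsub.
suff h k m (f : 'I_m -> T) : (a - \rank (\matrix_i u (f i)) <= k)%N ->
    exists m (f : 'I_m -> T), forall tau, (u tau <= \matrix_i u (f i))%MS.
  by apply: (h a 0%N (fun i => False_rect _ (notF (ltn_ord i)))); apply: leq_subr.
elim: k m f => [|k IH] m f lek.
  exists m, f => tau; apply: submx_full.
  by rewrite /row_full eqn_leq rank_leq_col /=; rewrite leqn0 subn_eq0 in lek.
have [span|] := EM (forall tau, (u tau <= \matrix_i u (f i))%MS); first by exists m, f.
move/existsNP=> [tau /negP ntau].
pose f' (i : 'I_(m + 1)) := match split i with inl j => f j | inr _ => tau end.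
have f'E : \matrix_i u (f' i) = col_mx (\matrix_i u (f i)) (u tau).
  apply/matrixP=> i j; rewrite !mxE /f'; case: split => k' ; rewrite ?mxE //.
  by rewrite ord1.
apply: (IH _ f'); rewrite f'E.
have : (\rank (\matrix_i u (f i)) < \rank (col_mx (\matrix_i u (f i)) (u tau)))%N.
  by apply: rank_ltmx; rewrite ltmxE col_mx_sub negb_and ntau orbT andbT -addsmxE addsmxSl.
by move: lek; clear; lia.
Qed.

(* [C = D^T Q^-1 E], with [D] and [E] the images of a maximal independent
   family and [Q] their common Gram matrix: the partial isometry [u tau -> v tau]
   extended by [0] on the orthogonal complement. *)
Lemma gram_transport (T : Type) a b (u : T -> 'rV[R]_a) (v : T -> 'rV[R]_b) :
  (forall s r, u s *m (u r)^T = v s *m (v r)^T) ->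
  exists C : 'M[R]_(a, b),
    [/\ forall s, u s *m C = v s,
        forall s, v s *m C^T = u s,
        forall (X : 'M_a) (Y : 'M_b),
          (forall s, exists r, u s *m X = u r /\ v s *m Y = v r) ->
          (forall s, exists r, u s *m X^T = u r /\ v s *m Y^T = v r) ->
          X *m C = C *m Y &
        forall p (X : 'M_(a, p)) (Y : 'M_(b, p)),
          (forall s, u s *m X = v s *m Y) -> C^T *m X = C^T *m C *m Y].
Proof.
move=> gram; have [m [f [free span]]] := exists_spanning u.
pose D := \matrix_i u (f i); pose E := \matrix_i v (f i).
pose Q := D *m D^T.
have mulE n p q (A : 'M[R]_(n, p)) (B : 'M[R]_(q, p)) i j :
    (A *m B^T) i j = (row i A *m (row j B)^T) 0 0.
  by rewrite !mxE; apply: eq_bigr => k _; rewrite !mxE.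
have QE : E *m E^T = Q.
  by apply/matrixP=> i j; rewrite [LHS]mulE [RHS]mulE !rowK gram.
have uD s : u s *m D^T = v s *m E^T.
  by apply/matrixP=> i j; rewrite [LHS]mulE [RHS]mulE !rowK !row_id gram.
(* If [w *m Q = 0] then [w *m D] has norm zero, and the rows of [D] are independent. *)
have Qu : Q \in unitmx.
  rewrite -row_free_unit; apply: inj_row_free => w wQ.
  have : w *m D = 0.
    by apply: row_norm0; rewrite trmx_mul mulmxA -[w *m _ *m _]mulmxA -/Q wQ mul0mx.
  by move/eqP; rewrite mulmx_free_eq0 // => /eqP.
have Qs : (invmx Q)^T = invmx Q by rewrite trmx_inv /Q trmx_mul trmxK.
(* The norm of [v s - c *m E] is a combination of inner products, which agree with those for
   [u s - c *m D = 0]. *)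
have uv s c : u s = c *m D -> v s = c *m E.
  move=> e; apply/eqP; rewrite -subr_eq0; apply/eqP/row_norm0.
  rewrite linearB /= mulmxBl !mulmxBr trmx_mul !mulmxA -uD -[c *m E *m E^T]mulmxA QE.
  have -> : c *m E *m (v s)^T = c *m D *m (u s)^T.
    by rewrite -!mulmxA; congr (_ *m _); apply: trmx_inj; rewrite !trmx_mul !trmxK uD.
  by rewrite -gram e trmx_mul /Q !mulmxA !subrr.
have cD s : exists c, u s = c *m D by apply/submxP.
pose C := D^T *m invmx Q *m E.
have CT : C^T = E^T *m invmx Q *m D by rewrite !trmx_mul Qs trmxK mulmxA.
have DC : D *m C = E by rewrite /C !mulmxA mulmxV // mul1mx.
have EC : E *m C^T = D by rewrite CT !mulmxA QE mulmxV // mul1mx.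
have uC s : u s *m C = v s.
  by have [c e] := cD s; rewrite e (uv _ _ e) -mulmxA DC.
exists C; split=> //.
- by move=> s; have [c e] := cD s; rewrite (uv _ _ e) -mulmxA EC.
- move=> X Y XY XYT.
  have h : D *m X *m C = E *m Y.
    apply/row_matrixP=> i; rewrite !row_mul !rowK.
    by have [r [-> ->]] := XY (f i); apply: uC.
  (* [X^T] preserves the row space of [D], so the columns of [X *m C] lie in that span, where the
     projection [D^T *m invmx Q *m D] is the identity. *)
  have [W hW] : exists W, D *m X^T = W *m D.
    apply/submxP/row_subP=> i; rewrite row_mul rowK.
    by have [r [-> _]] := XYT (f i).
  have XD : X *m D^T = D^T *m W^T by rewrite -trmx_mul -hW trmx_mul trmxK.
  have XC : X *m C = D^T *m (W^T *m invmx Q *m E) by rewrite /C !mulmxA XD.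
  rewrite [in RHS]/C -[RHS]mulmxA -h -[D *m X *m C]mulmxA XC !mulmxA.
  rewrite -[D^T *m invmx Q *m D *m D^T]mulmxA -/Q.
  by rewrite -[D^T *m invmx Q *m Q]mulmxA mulVmx // mulmx1.
- move=> p X Y XY; have DX : D *m X = E *m Y.
    by apply/row_matrixP=> i; rewrite !row_mul !rowK.
  by rewrite CT -[LHS]mulmxA DX -[_ *m D *m C]mulmxA DC mulmxA.
Qed.

Lemma sum_enum_val (A : finType) (F : A -> R) :
  \sum_(i < #|A|) F (enum_val i) = \sum_x F x.
Proof.
rewrite [RHS](reindex (@enum_val A predT)) //.
by apply: onW_bij; apply: enum_val_bij.
Qed.

Lemma gram_transport_fun (T : Type) (A B : finType) (u : T -> A -> R)
    (v : T -> B -> R) :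
  (forall s r, \sum_x u s x * u r x = \sum_k v s k * v r k) ->
  exists C : A -> B -> R,
    [/\ forall s k, \sum_x u s x * C x k = v s k,
        forall s x, \sum_k v s k * C x k = u s x,
        forall (X : A -> A -> R) (Y : B -> B -> R),
          (forall s, exists r, (forall x', \sum_x u s x * X x x' = u r x') /\
             (forall k', \sum_k v s k * Y k k' = v r k')) ->
          (forall s, exists r, (forall x, \sum_x' u s x' * X x x' = u r x) /\
             (forall k, \sum_k' v s k' * Y k k' = v r k)) ->
          forall x k, \sum_x' X x x' * C x' k = \sum_k' C x k' * Y k' k &
        forall (X : A -> R) (Y : B -> R),
          (forall s, \sum_x u s x * X x = \sum_k v s k * Y k) ->
          forall k, \sum_x C x k * X x = \sum_k' (\sum_x C x k * C x k') * Y k'].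
Proof.
move=> gram.
pose U s : 'rV_#|A| := \row_i u s (enum_val i).
pose V s : 'rV_#|B| := \row_i v s (enum_val i).
have gramM s r : U s *m (U r)^T = V s *m (V r)^T.
  apply/matrixP=> i j; rewrite !mxE.
  under eq_bigr => k _ do rewrite !mxE; under [RHS]eq_bigr => k _ do rewrite !mxE.
  by rewrite (sum_enum_val (fun x => u s x * u r x)) (sum_enum_val (fun x => v s x * v r x)).
have [C [uC vC comm tr]] := gram_transport gramM.
exists (fun x k => C (enum_rank x) (enum_rank k)); split.
- move=> s k; have /rowP/(_ (enum_rank k)) := uC s; rewrite !mxE enum_rankK => <-.
  rewrite -sum_enum_val; apply: eq_bigr => i _.
  by rewrite !mxE enum_valK.
- move=> s x; have /rowP/(_ (enum_rank x)) := vC s; rewrite !mxE enum_rankK => <-.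
  rewrite -sum_enum_val; apply: eq_bigr => i _.
  by rewrite !mxE enum_valK.
- move=> X Y h1 h2 x k.
  have : (\matrix_(i, j) X (enum_val i) (enum_val j)) *m C =
      C *m (\matrix_(i, j) Y (enum_val i) (enum_val j)).
    apply: comm => s.
      have [r [r1 r2]] := h1 s; exists r.
      by split; apply/rowP=> i; rewrite !mxE -?r1 -?r2 -[RHS]sum_enum_val;
      apply: eq_bigr => j _; rewrite !mxE.
    have [r [r1 r2]] := h2 s; exists r.
    by split; apply/rowP=> i; rewrite !mxE -?r1 -?r2 -[RHS]sum_enum_val;
      apply: eq_bigr => j _; rewrite !mxE.
  move/matrixP/(_ (enum_rank x) (enum_rank k)).
  rewrite !mxE => H; rewrite -sum_enum_val -[in RHS]sum_enum_val.
  etransitivity; first (etransitivity; last exact: H);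
    by apply: eq_bigr => i _; rewrite !mxE ?enum_rankK ?enum_valK.
- move=> X Y h k.
  have : C^T *m (\col_i X (enum_val i)) = C^T *m C *m (\col_i Y (enum_val i)).
    apply: tr => s; apply/matrixP=> i j; rewrite !mxE.
    transitivity (\sum_x u s x * X x).
      by rewrite -[RHS]sum_enum_val; apply: eq_bigr => l _; rewrite !mxE.
    by rewrite h -sum_enum_val; apply: eq_bigr => l _; rewrite !mxE.
  move/colP/(_ (enum_rank k)).
  rewrite !mxE => H; rewrite -sum_enum_val -[in RHS]sum_enum_val.
  etransitivity; first (etransitivity; last exact: H);
    apply: eq_bigr => i _; rewrite !mxE ?enum_valK //; congr (_ * _).
  by rewrite -[RHS]sum_enum_val; apply: eq_bigr => l _; rewrite !mxE enum_valK.
Qed.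

(** A symmetric [Y] has the row space of its square. Hence [Y = X *m Y *m Y] for some [X], and the
    form at [x] equals the form at [x *m X *m Y], a point of the image. *)
Lemma psd_from_image_mx n (Y : 'M[R]_n) : Y^T = Y ->
  (forall z : 'rV_n, 0 <= (z *m Y *m Y *m (z *m Y)^T) 0 0) ->
  forall x : 'rV_n, 0 <= (x *m Y *m x^T) 0 0.
Proof.
move=> Ys pos x.
have /submxP[X hX] : (Y <= Y *m Y)%MS.
  have := mxrank_leqif_sup (submxMl Y Y); move/geq_leqif <-.
  have := mxrank_mul_ker Y Y => <-.
  (* By symmetry the kernel is orthogonal to the image. *)
  suff -> : (Y :&: kermx Y)%MS = 0 by rewrite mxrank0 addn0.
  apply/eqP/rowV0P=> w; rewrite sub_capmx => /andP[/submxP[z wz] /sub_kermxP wY].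
  by apply: row_norm0; rewrite {1}wz -mulmxA -{1}Ys -trmx_mul wY trmx0 mulmx0.
have -> : x *m Y *m x^T = x *m X *m Y *m Y *m (x *m X *m Y)^T; last exact: pos.
have xY : x *m Y = x *m X *m Y *m Y by rewrite {1}hX !mulmxA.
have Yx : Y *m x^T = Y *m Y *m (x *m X)^T.
  by rewrite -{1}Ys -trmx_mul xY !trmx_mul Ys !mulmxA.
by rewrite -xY -mulmxA Yx [(_ *m Y)^T]trmx_mul Ys !mulmxA.
Qed.

Lemma psd_from_image (P : finType) (K : P -> P -> R) :
  (forall p q, K p q = K q p) ->
  (forall z : P -> R,
     0 <= \sum_p \sum_q (\sum_r K p r * z r) * (\sum_r K q r * z r) * K p q) ->
  forall x : P -> R, 0 <= \sum_p \sum_q x p * x q * K p q.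
Proof.
move=> sym pos x.
pose Y : 'M[R]_#|P| := \matrix_(i, j) K (enum_val i) (enum_val j).
have Ys : Y^T = Y by apply/matrixP=> i j; rewrite !mxE sym.
have quad (w : 'rV_#|P|) : (w *m Y *m w^T) 0 0 =
    \sum_p \sum_q w 0 (enum_rank p) * w 0 (enum_rank q) * K p q.
  rewrite [RHS]exchange_big -[RHS]sum_enum_val mxE; apply: eq_bigr => j _.
  rewrite mxE mulr_suml -[RHS]sum_enum_val; apply: eq_bigr => i _.
  by rewrite !mxE !enum_valK; ring.
have zY (z : 'rV_#|P|) p :
    (z *m Y) 0 (enum_rank p) = \sum_r K p r * z 0 (enum_rank r).
  rewrite mxE -[RHS]sum_enum_val; apply: eq_bigr => i _.
  by rewrite mxE enum_rankK enum_valK sym mulrC.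
have posY (z : 'rV_#|P|) : 0 <= (z *m Y *m Y *m (z *m Y)^T) 0 0.
  rewrite quad; have := pos (fun p => z 0 (enum_rank p)); congr (_ <= _).
  by apply: eq_bigr => p _; apply: eq_bigr => q _; rewrite !zY.
have := psd_from_image_mx Ys posY (\row_i x (enum_val i)).
rewrite quad; congr (_ <= _).
by apply: eq_bigr => p _; apply: eq_bigr => q _; rewrite !mxE !enum_rankK.
Qed.

End Gram.

(** * Completeness *)

Definition term (t : nat) : Type := {s : scheme t & ann s}.

Definition tev t (r : term t) (G : graph) (x : {ffun ctx t -> G}) : nat :=
  ev (projT2 r) x.

Lemma term_ren t (p : {perm ctx t}) (cs : bool -> rel (ctx t)) (r : term t) :
  exists r' : term t, forall (G : graph) (x : {ffun ctx t -> G}),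
    tev r' x = (compat cs x * tev r [ffun c => x (p c)])%N.
Proof.
case: r => s a; exists (existT _ (Ren p s) ((cs, a) : ann (Ren p s))) => G x.
exact: ev_ren.
Qed.

Lemma term_perm t (p : {perm ctx t}) (r : term t) :
  exists r' : term t, forall (G : graph) (x : {ffun ctx t -> G}),
    tev r' x = tev r [ffun c => x (p c)].
Proof.
have [r' h] := term_ren p (fun _ _ _ => false) r; exists r' => G x.
rewrite h; suff -> : compat (fun _ _ _ => false) x by rewrite mul1n.
by apply/compatP.
Qed.

Lemma term_compat t (cs : bool -> rel (ctx t)) (r : term t) :
  exists r' : term t, forall (G : graph) (x : {ffun ctx t -> G}),
    tev r' x = (compat cs x * tev r x)%N.
Proof.
have [r' h] := term_ren 1 cs r; exists r' => G x; rewrite h.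
by congr (_ * tev r _)%N; apply/ffunP=> c; rewrite ffunE perm1.
Qed.

Lemma term_one t : exists r : term t, forall (G : graph) (x : {ffun ctx t -> G}),
  tev r x = 1%N.
Proof.
by exists (existT _ Leaf (tt : ann Leaf)) => G x; apply: ev_leaf.
Qed.

Lemma term_ser t (r1 r2 : term t) :
  exists r : term t, forall (G : graph) (x : {ffun ctx t -> G}),
    tev r x = (\sum_(y : {ffun 'I_t -> G})
      tev r1 (fjoin (lpart x) y) * tev r2 (fjoin y (rpart x)))%N.
Proof.
case: r1 r2 => [s1 a1] [s2 a2].
by exists (existT _ (Ser s1 s2) ((a1, a2) : ann (Ser s1 s2))) => G x; apply: ev_ser.
Qed.

(** With [P] total this is the diagonal, which produces inner products; with [P] omitting one
    position it is the operator that sums out one coordinate. *)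
Definition diag_constr (t : nat) (P : pred 'I_t) : bool -> rel (ctx t) :=
  fun b c d => match c, d with inl i, inr j => [&& ~~ b, i == j & P i] | _, _ => false end.

Lemma compat_diag t (P : pred 'I_t) (G : graph) (g g' : {ffun 'I_t -> G}) :
  compat (diag_constr P) (fjoin g g') = [forall i, P i ==> (g i == g' i)].
Proof.
apply/compatP/forallP => [h i|h [i|i] [j|j]] //=.
  apply/implyP=> Pi; have [_] := h (inl i) (inr i); rewrite !ffunE /= eqxx.
  by move=> /(_ Pi) ->.
split=> // /andP[/eqP <- Pi]; rewrite !ffunE.
by have /implyP/(_ Pi)/eqP := h i.
Qed.

Lemma term_diag t (P : pred 'I_t) :
  exists r : term t, forall (G : graph) (g g' : {ffun 'I_t -> G}),
    tev r (fjoin g g') = [forall i, P i ==> (g i == g' i)].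
Proof.
have [r0 h0] := term_one t; have [r h] := term_compat (diag_constr P) r0.
by exists r => G g g'; rewrite h h0 muln1 compat_diag.
Qed.

Lemma sum_deltan (I : finType) (i : I) (F : I -> nat) :
  (\sum_j (j == i) * F j = F i)%N.
Proof.
rewrite (bigD1 i) //= eqxx mul1n big1 ?addn0 // => j /negbTE ->.
by rewrite mul0n.
Qed.

(** The inner product is the trace of [r1] composed with the transpose of [r2]: a series composition
    restricted to the diagonal. *)
Lemma term_gram t (r1 r2 : term t) :
  exists r : term t, forall G : graph,
    (\sum_(x : {ffun ctx t -> G}) tev r x =
     \sum_(x : {ffun ctx t -> G}) tev r1 x * tev r2 x)%N.
Proof.
have [r2' h2] := term_perm (swap_perm t) r2.
have [r0 h0] := term_ser r1 r2'; have [r h] := term_compat (diag_constr predT) r0.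
exists r => G; rewrite !big_fjoin; apply: eq_bigr => g _.
transitivity (\sum_g' (g' == g) * tev r0 (fjoin g g'))%N.
  apply: eq_bigr => g' _; rewrite h compat_diag; congr (nat_of_bool _ * _)%N.
  apply/forallP/eqP => [e|-> i]; last by rewrite eqxx implybT.
  by apply/ffunP=> i; have /eqP -> := e i.
rewrite sum_deltan h0 fjoinK1 fjoinK2; apply: eq_bigr => y _.
by rewrite h2 fjoin_swap.
Qed.

Lemma sum_off (R : nmodType) (I T : finType) (g : {ffun I -> T}) j
    (F : {ffun I -> T} -> R) :
  \sum_(y : {ffun I -> T} | [forall i, (i != j) ==> (g i == y i)]) F y =
  \sum_v F (upd g j v).
Proof.
rewrite (reindex_onto (fun v => upd g j v) (fun y : {ffun I -> T} => y j)) /=; last first.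
  move=> y /forallP h; apply/ffunP=> i; rewrite ffunE.
  by case: eqP => [-> //|/eqP ij]; have /implyP/(_ ij)/eqP := h i.
apply: eq_bigl => v; rewrite !ffunE !eqxx andbT.
by apply/forallP=> i; apply/implyP=> /negbTE ij; rewrite ffunE ij.
Qed.

(** The kernel commutes with summing out one coordinate. Together with [ts_eq] this yields the
    marginal constraints. *)
Definition balanced (R : realFieldType) (t : nat) (G H : graph)
    (Z : {ffun ctx t -> G} -> {ffun ctx t -> H} -> R) :=
  forall c x k, \sum_w Z (upd x c w) k = \sum_v Z x (upd k c v).

Section Completeness.
Variables (R : realFieldType) (t : nat) (G H : graph).
Hypothesis sums : forall r : term t,
  (\sum_(x : {ffun ctx t -> G}) tev r x = \sum_(k : {ffun ctx t -> H}) tev r k)%N.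

Let u (r : term t) (x : {ffun ctx t -> G}) : R := (tev r x)%:R.
Let v (r : term t) (k : {ffun ctx t -> H}) : R := (tev r k)%:R.

Lemma terms_gram s r : \sum_x u s x * u r x = \sum_k v s k * v r k.
Proof.
have [q h] := term_gram s r; rewrite /u /v.
under eq_bigr => x _ do rewrite -natrM; under [RHS]eq_bigr => k _ do rewrite -natrM.
by rewrite -!natr_sum -!h sums.
Qed.

Section Transport.
Variable C : {ffun ctx t -> G} -> {ffun ctx t -> H} -> R.
Hypotheses
  (uC : forall s k, \sum_x u s x * C x k = v s k)
  (vC : forall s x, \sum_k v s k * C x k = u s x)
  (comm : forall X Y,
    (forall s, exists r, (forall x', \sum_x u s x * X x x' = u r x') /\
      (forall k', \sum_k v s k * Y k k' = v r k')) ->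
    (forall s, exists r, (forall x, \sum_x' u s x' * X x x' = u r x) /\
      (forall k, \sum_k' v s k' * Y k k' = v r k)) ->
    forall x k, \sum_x' X x x' * C x' k = \sum_k' C x k' * Y k' k)
  (tr : forall X Y, (forall s, \sum_x u s x * X x = \sum_k v s k * Y k) ->
    forall k, \sum_x C x k * X x = \sum_k' (\sum_x C x k * C x k') * Y k').

(** The adjoint of a permutation of labels is the inverse permutation, so both preserve the terms
    and [comm] applies. *)
Lemma transport_perm (p : {perm ctx t}) (x : {ffun ctx t -> G}) (k : {ffun ctx t -> H}) :
  C [ffun c => x (p c)] [ffun c => k (p c)] = C x k.
Proof.
pose X (A : graph) (z z' : {ffun ctx t -> A}) : R := (z' == [ffun c => z (p c)])%:R.
have XE (A : graph) (z z' : {ffun ctx t -> A}) :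
    X A z z' = (z == [ffun c => z' (p^-1%g c)])%:R.
  congr (nat_of_bool _)%:R; apply/eqP/eqP => ->; apply/ffunP=> c; rewrite !ffunE.
    by rewrite permKV.
  by rewrite permK.
have e1 s : exists r, (forall x', \sum_x u s x * X G x x' = u r x') /\
      (forall k', \sum_k v s k * X H k k' = v r k').
  have [r h] := term_perm p^-1 s; exists r; rewrite /u /v; split=> y; rewrite h.
    by under eq_bigr => z _ do rewrite XE mulrC; rewrite sum_delta.
  by under eq_bigr => z _ do rewrite XE mulrC; rewrite sum_delta.
have e2 s : exists r, (forall x, \sum_x' u s x' * X G x x' = u r x) /\
      (forall k, \sum_k' v s k' * X H k k' = v r k).
  have [r h] := term_perm p s; exists r; rewrite /u /v; split=> y; rewrite h.
    by under eq_bigr => z _ do rewrite mulrC; rewrite sum_delta.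
  by under eq_bigr => z _ do rewrite mulrC; rewrite sum_delta.
have := comm e1 e2 x [ffun c => k (p c)]; rewrite sum_delta => ->.
under eq_bigr => z _ do rewrite XE mulrC; rewrite sum_delta; congr (C x _).
by apply/ffunP=> c; rewrite !ffunE permKV.
Qed.

(** Multiplication by the indicator of [compat cs] is self-adjoint and preserves the terms;
    commuting with it, [C] vanishes wherever the two indicators differ. *)
Lemma transport_compat cs x k : C x k != 0 -> compat cs x = compat cs k.
Proof.
pose X (A : graph) (z z' : {ffun ctx t -> A}) : R := (z' == z)%:R * (compat cs z)%:R.
have e s : exists r, (forall x', \sum_x u s x * X G x x' = u r x') /\
      (forall k', \sum_k v s k * X H k k' = v r k').
  have [r h] := term_compat cs s; exists r; rewrite /u /v; split=> y; rewrite h natrM.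
    rewrite -[RHS](sum_delta y (fun z => (compat cs z)%:R * (tev s z)%:R)).
    by apply: eq_bigr => z _; rewrite /X eq_sym; ring.
  rewrite -[RHS](sum_delta y (fun z => (compat cs z)%:R * (tev s z)%:R)).
  by apply: eq_bigr => z _; rewrite /X eq_sym; ring.
have e' s : exists r, (forall x, \sum_x' u s x' * X G x x' = u r x) /\
      (forall k, \sum_k' v s k' * X H k k' = v r k).
  have [r h] := term_compat cs s; exists r; rewrite /u /v; split=> y; rewrite h natrM.
    rewrite -[RHS](sum_delta y (fun z => (compat cs y)%:R * (tev s z)%:R)).
    by apply: eq_bigr => z _; rewrite /X; ring.
  rewrite -[RHS](sum_delta y (fun z => (compat cs y)%:R * (tev s z)%:R)).
  by apply: eq_bigr => z _; rewrite /X; ring.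
have := comm e e' x k; rewrite /X => c nz.
have {c} : (compat cs x)%:R * C x k = (compat cs k)%:R * C x k.
  rewrite -[LHS](sum_delta x (fun z => (compat cs x)%:R * C z k)).
  rewrite -[RHS](sum_delta k (fun z => (compat cs z)%:R * C x z)).
  under eq_bigr => z _ do rewrite mulrA; rewrite c.
  by apply: eq_bigr => z _; rewrite eq_sym; ring.
by move/(mulIf nz)/eqP; rewrite eqr_nat; do 2!case: compat.
Qed.

(** The operator is series composition with [r] on the first half; its adjoint composes with the
    swap of [r], again a term. *)
Lemma transport_left r g g2 h' h2 :
  \sum_y u r (fjoin g y) * C (fjoin y g2) (fjoin h' h2) =
  \sum_y v r (fjoin y h') * C (fjoin g g2) (fjoin y h2).
Proof.
pose X (A : graph) (x x' : {ffun ctx t -> A}) : R :=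
  (rpart x' == rpart x)%:R * (tev r (fjoin (lpart x) (lpart x')))%:R.
have [r' h'E] := term_perm (swap_perm t) r.
have XR (A : graph) (F : {ffun ctx t -> A} -> R) x :
    \sum_x' F x' * X A x x' = \sum_y (tev r (fjoin (lpart x) y))%:R * F (fjoin y (rpart x)).
  rewrite big_fjoin; apply: eq_bigr => y _.
  rewrite -[RHS](sum_delta (rpart x) (fun z => (tev r (fjoin (lpart x) y))%:R * F (fjoin y z))).
  by apply: eq_bigr => z _; rewrite /X fjoinK1 fjoinK2; ring.
have XL (A : graph) (F : {ffun ctx t -> A} -> R) x' :
    \sum_x F x * X A x x' = \sum_y (tev r (fjoin y (lpart x')))%:R * F (fjoin y (rpart x')).
  rewrite big_fjoin; apply: eq_bigr => y _.
  rewrite -[RHS](sum_delta (rpart x') (fun z => (tev r (fjoin y (lpart x')))%:R * F (fjoin y z))).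
  by apply: eq_bigr => z _; rewrite /X fjoinK1 fjoinK2 eq_sym; ring.
have e1 s : exists r, (forall x', \sum_x u s x * X G x x' = u r x') /\
      (forall k', \sum_k v s k * X H k k' = v r k').
  have [q qE] := term_ser r' s; exists q; split=> y; rewrite /u /v qE XL natr_sum;
    by apply: eq_bigr => z _; rewrite natrM h'E fjoin_swap.
have e2 s : exists r, (forall x, \sum_x' u s x' * X G x x' = u r x) /\
      (forall k, \sum_k' v s k' * X H k k' = v r k).
  have [q qE] := term_ser r s; exists q; split=> y; rewrite /u /v qE XR natr_sum;
    by apply: eq_bigr => z _; rewrite natrM.
have := comm e1 e2 (fjoin g g2) (fjoin h' h2); rewrite XL fjoinK1 fjoinK2 => <-.
under [RHS]eq_bigr => z _ do rewrite mulrC.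
by rewrite XR fjoinK1 fjoinK2.
Qed.

Lemma upd_fjoin_inl (T : finType) (g g' : {ffun 'I_t -> T}) j w :
  upd (fjoin g g') (inl j) w = fjoin (upd g j w) g'.
Proof.
by apply/ffunP=> -[i|i]; rewrite !ffunE //= ffunE.
Qed.

Lemma transport_balanced : balanced C.
Proof.
have left j x k : \sum_w C (upd x (inl j) w) k = \sum_w C x (upd k (inl j) w).
  rewrite -[x]fjoin_parts -[k]fjoin_parts.
  move: (lpart x) (rpart x) (lpart k) (rpart k) => g g2 h' h2.
  (* Composing with this term leaves every position but [j] fixed and sums over position [j]. *)
  have [r rE] := term_diag (fun i => i != j).
  under eq_bigr => w _ do rewrite upd_fjoin_inl.
  under [RHS]eq_bigr => w _ do rewrite upd_fjoin_inl.
  rewrite -(sum_off _ _ (fun z => C (fjoin z g2) _)) -(sum_off _ _ (fun z => C _ (fjoin z h2))).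
  have e := transport_left r g g2 h' h2; rewrite big_mkcond [in RHS]big_mkcond /=.
  etransitivity; first (etransitivity; last exact: e); apply: eq_bigr => z _;
    rewrite /u /v rE; first by case: ifP; rewrite ?mul1r ?mul0r.
  rewrite (_ : [forall i, _] = [forall i, (i != j) ==> (h' i == z i)]); last first.
    by apply: eq_forallb => i; rewrite [z i == _]eq_sym.
  by case: ifP; rewrite ?mul1r ?mul0r.
case=> j x k; first exact: left.
have updE (A : finType) (z : {ffun ctx t -> A}) w :
    [ffun c => upd z (inr j) w (swap_perm t c)] =
    upd [ffun c => z (swap_perm t c)] (inl j) w.
  by apply/ffunP=> -[i|i]; rewrite !ffunE permE.
under eq_bigr => w _ do rewrite -(transport_perm (swap_perm t)) updE.
by rewrite left; apply: eq_bigr => w _; rewrite -updE transport_perm.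
Qed.

(* [K] is symmetric, and on its image it acts as right multiplication by the
   matrix [sum_h' (C^T C) ((h, h'), (h1, h'))], a sum of Gram matrices. *)
Lemma transport_psd (x : {ffun 'I_t -> G} * {ffun 'I_t -> H} -> R) :
  0 <= \sum_p \sum_q x p * x q * C (fjoin p.1 q.1) (fjoin p.2 q.2).
Proof.
apply: (@psd_from_image _ _ (fun p q => C (fjoin p.1 q.1) (fjoin p.2 q.2))) => [p q|z].
  by rewrite -(transport_perm (swap_perm t)) !fjoin_swap.
pose W (p : {ffun 'I_t -> G} * {ffun 'I_t -> H}) :=
  \sum_r C (fjoin p.1 r.1) (fjoin p.2 r.2) * z r.
suff : 0 <= \sum_p \sum_q W p * W q * C (fjoin p.1 q.1) (fjoin p.2 q.2) by [].
have int r g h' : \sum_g' u r (fjoin g g') * W (g', h') = \sum_h v r (fjoin h h') * W (g, h).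
  under eq_bigr => g' _ do rewrite mulr_sumr; rewrite exchange_big.
  under [RHS]eq_bigr => h _ do rewrite mulr_sumr; rewrite [RHS]exchange_big.
  apply: eq_bigr => q _ /=.
  under eq_bigr => g' _ do rewrite mulrA; rewrite -mulr_suml transport_left mulr_suml.
  by apply: eq_bigr => h _; rewrite mulrA.
have act g h h' : \sum_g' C (fjoin g g') (fjoin h h') * W (g', h') =
    \sum_h1 (\sum_x C x (fjoin h h') * C x (fjoin h1 h')) * W (g, h1).
  have := tr (X := fun a => (lpart a == g)%:R * W (rpart a, h'))
    (Y := fun b => (rpart b == h')%:R * W (g, lpart b)).
  have XE (F : {ffun ctx t -> G} -> R) :
      \sum_x F x * ((lpart x == g)%:R * W (rpart x, h')) =
      \sum_g' F (fjoin g g') * W (g', h').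
    rewrite big_fjoin exchange_big; apply: eq_bigr => g' _.
    rewrite -[RHS](sum_delta g (fun y => F (fjoin y g') * W (g', h'))).
    by apply: eq_bigr => y _; rewrite fjoinK1 fjoinK2 mulrCA.
  have YE (F : {ffun ctx t -> H} -> R) :
      \sum_k F k * ((rpart k == h')%:R * W (g, lpart k)) =
      \sum_h1 F (fjoin h1 h') * W (g, h1).
    rewrite big_fjoin; apply: eq_bigr => h1 _.
    rewrite -[RHS](sum_delta h' (fun y => F (fjoin h1 y) * W (g, h1))).
    by apply: eq_bigr => y _; rewrite fjoinK1 fjoinK2 mulrCA.
  move=> H0; have {H0} := H0 _ (fjoin h h'); rewrite XE YE; apply.
  by move=> s; rewrite XE YE int.
have -> : \sum_p \sum_q W p * W q * C (fjoin p.1 q.1) (fjoin p.2 q.2) =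
    \sum_g \sum_h' \sum_x (\sum_h W (g, h) * C x (fjoin h h')) ^+ 2.
  rewrite big_pair_sep; apply: eq_bigr => g _.
  under eq_bigr => h _ do rewrite big_pair_sep exchange_big.
  rewrite exchange_big; apply: eq_bigr => h' _ /=.
  transitivity (\sum_h W (g, h) * \sum_g' C (fjoin g g') (fjoin h h') * W (g', h')).
    apply: eq_bigr => h _; rewrite mulr_sumr; apply: eq_bigr => g' _.
    by ring.
  transitivity (\sum_h \sum_h1 \sum_x
    (W (g, h) * C x (fjoin h h')) * (W (g, h1) * C x (fjoin h1 h'))).
    apply: eq_bigr => h _; rewrite act mulr_sumr; apply: eq_bigr => h1 _.
    rewrite mulr_suml mulr_sumr; apply: eq_bigr => y _.
    by ring.
  transitivity (\sum_x \sum_h \sum_h1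
    (W (g, h) * C x (fjoin h h')) * (W (g, h1) * C x (fjoin h1 h'))).
    by rewrite [RHS]exchange_big; apply: eq_bigr => h _; apply: exchange_big.
  apply: eq_bigr => y _; rewrite expr2 mulr_suml; apply: eq_bigr => h _.
  by rewrite mulr_sumr.
by do 3![apply: sumr_ge0 => ? _]; apply: sqr_ge0.
Qed.

Lemma transport_solution : tuple_solution C.
Proof.
split.
- move=> x k c d nz.
  have := transport_compat (fun b c' d' => [&& ~~ b, c' == c & d' == d]) nz.
  have E (A : graph) (z : {ffun ctx t -> A}) :
      compat (fun b c' d' => [&& ~~ b, c' == c & d' == d]) z = (z c == z d).
    apply/compatP/eqP => [/(_ c d)[_]|e a b]; first by apply; rewrite !eqxx.
    by split=> // /and3P[_ /eqP -> /eqP ->].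
  by rewrite !E.
- move=> x k c d nz.
  have := transport_compat (fun b c' d' => [&& b, c' == c & d' == d]) nz.
  have E (A : graph) (z : {ffun ctx t -> A}) :
      compat (fun b c' d' => [&& b, c' == c & d' == d]) z = edge (z c) (z d).
    apply/compatP/idP => [/(_ c d)[+ _]|e a b]; first by apply; rewrite !eqxx.
    by split=> // /and3P[_ /eqP -> /eqP ->].
  by rewrite !E.
- move=> x; have [r rE] := term_one t; have := vC r x; rewrite /u /v rE mulr1n => <-.
  by apply: eq_bigr => k _; rewrite rE mul1r.
- move=> k; have [r rE] := term_one t; have := uC r k; rewrite /u /v rE mulr1n => <-.
  by apply: eq_bigr => x _; rewrite rE mul1r.
- exact: transport_perm.
- exact: transport_psd.
Qed.

End Transport.

Theorem exists_tuple_solution :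
  exists C : {ffun ctx t -> G} -> {ffun ctx t -> H} -> R,
    tuple_solution C /\ balanced C.
Proof.
have [C [uC vC comm tr]] := gram_transport_fun terms_gram.
exists C; split; first exact: (transport_solution uC vC comm tr).
exact: (transport_balanced comm).
Qed.

End Completeness.

(** * From tuple solutions to Lasserre solutions *)

Section ToLasserre.
Variables (R : realType) (t : nat) (G H : graph).
Variable C : {ffun ctx t -> G} -> {ffun ctx t -> H} -> R.
Hypotheses (t0 : (0 < t)%N) (sol : tuple_solution C) (bal : balanced C).

Definition fsts (l : {ffun ctx t -> G * H}) : {ffun ctx t -> G} := [ffun c => (l c).1].
Definition snds (l : {ffun ctx t -> G * H}) : {ffun ctx t -> H} := [ffun c => (l c).2].
Definition val_of (l : {ffun ctx t -> G * H}) : R := C (fsts l) (snds l).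

(** A repetition in [k] forces the same repetition in the first argument, so one summand
    survives. *)
Lemma sum_dup_l c0 c1 (x : {ffun ctx t -> G}) (k : {ffun ctx t -> H}) :
  c0 != c1 -> k c0 = k c1 -> \sum_w C (upd x c0 w) k = C (upd x c0 (x c1)) k.
Proof.
move=> cc kk; rewrite (bigD1 (x c1)) //= big1 ?addr0 // => w wx.
apply/eqP/negPn/negP=> nz; move/eqP: wx; apply.
have := ts_eq sol c0 c1 nz; rewrite kk eqxx !ffunE eqxx [c1 == c0]eq_sym (negbTE cc).
by move/eqP.
Qed.

Lemma sum_dup_r c0 c1 (x : {ffun ctx t -> G}) (k : {ffun ctx t -> H}) :
  c0 != c1 -> x c0 = x c1 -> \sum_w C x (upd k c0 w) = C x (upd k c0 (k c1)).
Proof.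
move=> cc xx; rewrite (bigD1 (k c1)) //= big1 ?addr0 // => w wk.
apply/eqP/negPn/negP=> nz; move/eqP: wk; apply.
have := ts_eq sol c0 c1 nz; rewrite xx eqxx !ffunE eqxx [c1 == c0]eq_sym (negbTE cc).
by move/esym/eqP.
Qed.

Lemma upd_id (I : finType) (T : Type) (x : {ffun I -> T}) i : upd x i (x i) = x.
Proof. by apply/ffunP=> j; rewrite ffunE; case: eqP => // ->. Qed.

Lemma upd_upd (I : finType) (T : Type) (x : {ffun I -> T}) i v w :
  upd (upd x i v) i w = upd x i w.
Proof. by apply/ffunP=> j; rewrite !ffunE; case: eqP. Qed.

(** A repeated label is free to copy any other one: [balanced] at [c0] equates a sum that the
    repetition of [c2] collapses to the old value with a sum that the copy of [c1] collapses to the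
    new one. *)
Lemma val_of_move (l : {ffun ctx t -> G * H}) c0 c1 c2 :
  c0 != c2 -> l c0 = l c2 -> val_of (upd l c0 (l c1)) = val_of l.
Proof.
move=> c02 l02; have [<-|c01] := eqVneq c0 c1; first by rewrite upd_id.
have fE p : fsts (upd l c0 p) = upd (fsts l) c0 p.1.
  by apply/ffunP=> c; rewrite !ffunE; case: eqP.
have sE p : snds (upd l c0 p) = upd (snds l) c0 p.2.
  by apply/ffunP=> c; rewrite !ffunE; case: eqP.
rewrite /val_of fE sE.
have f1 : (l c1).1 = fsts l c1 by rewrite ffunE.
have s1 : (l c1).2 = upd (snds l) c0 (l c1).2 c1 by rewrite !ffunE eq_sym (negbTE c01).
have := bal c0 (upd (fsts l) c0 (fsts l c1)) (snds l).
under eq_bigr => w _ do rewrite upd_upd.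
rewrite (sum_dup_l _ c02); last by rewrite !ffunE l02.
rewrite (sum_dup_r _ c01); last by rewrite !ffunE eqxx eq_sym (negbTE c01).
have -> : fsts l c2 = fsts l c0 by rewrite !ffunE l02.
by rewrite upd_id f1 => ->; rewrite !ffunE.
Qed.

Lemma val_of_perm (p : {perm ctx t}) (l : {ffun ctx t -> G * H}) :
  val_of [ffun c => l (p c)] = val_of l.
Proof.
rewrite -[RHS](ts_perm sol p); congr C; apply/ffunP=> c; by rewrite !ffunE.
Qed.

Definition img (l : {ffun ctx t -> G * H}) : {set G * H} := [set l c | c : ctx t].

(** Induction on the number of positions where [l] and [l'] differ. If [l c] occurs twice in [l],
    position [c] is overwritten by [l' c]; otherwise [l c] is swapped into a position where [l'] has
    it. *)
Lemma val_of_img (l l' : {ffun ctx t -> G * H}) :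
  img l = img l' -> val_of l = val_of l'.
Proof.
have [n] := ubnP #|[set c | l c != l' c]|; elim: n l => // n IH l ltn im.
have [e|[c]] := set_0Vmem [set c | l c != l' c].
  congr val_of; apply/ffunP=> c; apply/eqP/negPn/negP=> cc.
  by have := in_set0 c; rewrite -e inE cc.
rewrite inE => cc.
have [/existsP[c2 /andP[c2c /eqP l2]]|ndup] := boolP [exists c2, (c2 != c) && (l c2 == l c)].
  have : l' c \in img l by rewrite im; apply: imset_f.
  case/imsetP=> c1 _ l1; rewrite -(val_of_move c1 (c0 := c) (c2 := c2)); last first.
  - by rewrite l2.
  - by rewrite eq_sym.
  apply: IH.
    rewrite -ltnS; apply: leq_trans ltn; rewrite ltnS; apply: proper_card.
    apply/properP; split.
      apply/subsetP=> d; rewrite !inE ffunE; case: (d =P c) => [->|//].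
      by rewrite -l1 eqxx.
    by exists c; rewrite !inE // ffunE eqxx -l1 eqxx.
  rewrite -im; apply/setP=> p; apply/imsetP/imsetP => -[d _ ->].
    by rewrite ffunE; case: eqP => _; [exists c1 | exists d].
  have [->|dc] := eqVneq d c; last by exists d; rewrite // ffunE (negbTE dc).
  by exists c2; rewrite // ffunE (negbTE c2c) l2.
have : l c \in img l' by rewrite -im; apply: imset_f.
case/imsetP=> d _ ld; have dc : d != c.
  by apply: contra cc => /eqP e; rewrite ld e.
have ldc : l d != l c.
  by apply: contra ndup => h; apply/existsP; exists d; rewrite dc.
rewrite -(val_of_perm (tperm c d)); apply: IH.
  rewrite -ltnS; apply: leq_trans ltn; rewrite ltnS; apply: proper_card.
  apply/properP; split.
    apply/subsetP=> e; rewrite !inE ffunE; case: tpermP => [->|->|//].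
      by rewrite cc.
    by rewrite ld eqxx.
  by exists d; rewrite !inE ?ffunE ?tpermR -ld ?eqxx.
rewrite -im; apply/setP=> p; apply/imsetP/imsetP => -[e _ ->].
  by exists (tperm c d e); rewrite ?ffunE.
by exists (tperm c d e); rewrite // ffunE tpermK.
Qed.

(** As [t > 0], no tuple has empty image, so the empty set gets its value separately; the default
    [0] then concerns only sets of more than [2 t] pairs. *)
Definition set_val (I : {set G * H}) : R :=
  if I == set0 then 1 else
  if [pick l | img l == I] is Some l then val_of l else 0.

Let c_ : ctx t := inl (Ordinal t0).

Lemma img_neq0 l : img l != set0.
Proof. by apply/set0Pn; exists (l c_); apply: imset_f. Qed.

Lemma set_val_img l : set_val (img l) = val_of l.
Proof.
rewrite /set_val (negbTE (img_neq0 l)); case: pickP => [l' /eqP|/(_ l)].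
  exact: val_of_img.
by rewrite eqxx.
Qed.

Lemma card_ctx : #|ctx t| = (2 * t)%N.
Proof. by rewrite card_sum !card_ord mul2n addnn. Qed.

Lemma img_surj (I : {set G * H}) :
  I != set0 -> (#|I| <= 2 * t)%N -> exists l, img l = I.
Proof.
case/set0Pn=> p pI leI.
(* The default [p], a member of [I], pads the enumeration to length [2 t]. *)
exists [ffun c => nth p (enum I) (enum_rank c)]; apply/setP=> q; apply/imsetP/idP.
  case=> c _ ->; rewrite ffunE.
  have [lt|ge] := ltnP (enum_rank c) (size (enum I)).
    by rewrite -mem_enum mem_nth.
  by rewrite nth_default.
rewrite -mem_enum => qI; have lt : (index q (enum I) < #|ctx t|)%N.
  by rewrite card_ctx; apply: leq_trans leI; rewrite cardE index_mem.
exists (enum_val (Ordinal lt)) => //.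
by rewrite ffunE enum_valK /= nth_index.
Qed.

Lemma img_dup (l : {ffun ctx t -> G * H}) :
  (#|img l| <= 2 * t - 1)%N -> exists c0 c1, c0 != c1 /\ l c0 = l c1.
Proof.
move=> leI; have : ~~ injectiveb l.
  apply/negP=> /injectiveP/card_imset; move/(_ (ctx t)) => e.
  by move: leI; rewrite /img e card_ctx; clear -t0; lia.
by case/injectivePn=> c0 [c1 cc ll]; exists c0, c1.
Qed.

Lemma img_upd (l : {ffun ctx t -> G * H}) c0 c1 p :
  c0 != c1 -> l c0 = l c1 -> img (upd l c0 p) = img l :|: [set p].
Proof.
move=> cc ll; apply/setP=> q; rewrite !inE; apply/imsetP/orP.
  case=> c _ ->; rewrite ffunE; case: eqP => _; first by right.
  by left; apply: imset_f.
case=> [/imsetP[c _ ->]|/eqP ->]; last by exists c0; rewrite // ffunE eqxx.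
have [->|ne] := eqVneq c c0; last by exists c; rewrite // ffunE (negbTE ne).
by exists c1; rewrite // ffunE eq_sym (negbTE cc).
Qed.

Lemma sum_const (D A : finType) (c : D) (F : {ffun D -> A} -> R) :
  (forall x d e, F x != 0 -> x d = x e) -> \sum_x F x = \sum_a F [ffun=> a].
Proof.
move=> Fc; rewrite (bigID (fun x : {ffun D -> A} => x == [ffun=> x c])) /=.
rewrite [X in _ + X]big1 ?addr0 => [|x]; last first.
  apply: contraNeq => nz; apply/eqP/ffunP=> d; rewrite ffunE.
  exact: Fc nz.
rewrite (reindex_onto (fun a : A => [ffun=> a]) (fun x : {ffun D -> A} => x c)) /=.
  by apply: eq_bigl => a; rewrite !ffunE !eqxx.
by move=> x /eqP.
Qed.

Lemma img_const p : img [ffun=> p] = [set p].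
Proof.
apply/setP=> q; rewrite inE; apply/imsetP/eqP => [[c _ ->]|->]; first by rewrite ffunE.
by exists c_; rewrite // ffunE.
Qed.

Lemma set_val1 g h : set_val [set (g, h)] = C [ffun=> g] [ffun=> h].
Proof.
rewrite -img_const set_val_img /val_of.
by congr C; apply/ffunP=> c; rewrite !ffunE.
Qed.

Lemma set_val0 : set_val set0 = 1.
Proof. by rewrite /set_val eqxx. Qed.

(** A tuple with at most [2 t - 1] values repeats one, and the spare label can store the additional
    pair. *)
Lemma set_val_upd (I : {set G * H}) : I != set0 -> (#|I| <= 2 * t - 1)%N ->
  exists (x : {ffun ctx t -> G}) (k : {ffun ctx t -> H}) c0 c1,
  [/\ c0 != c1, x c0 = x c1, k c0 = k c1, set_val I = C x k &
    forall g h, set_val (I :|: [set (g, h)]) = C (upd x c0 g) (upd k c0 h)].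
Proof.
move=> I0 leI; have [|l lI] := img_surj I0.
  by apply: leq_trans leI _; apply: leq_subr.
rewrite -{}lI in leI *; have [c0 [c1 [cc ll]]] := img_dup leI.
exists (fsts l), (snds l), c0, c1; split=> //; rewrite ?ffunE ?ll //.
  by rewrite set_val_img.
move=> g h; rewrite -(img_upd _ cc ll) set_val_img.
by congr C; apply/ffunP=> c; rewrite !ffunE; case: eqP.
Qed.

Lemma set_val_row (I : {set G * H}) g : (#|I| <= 2 * t - 1)%N ->
  \sum_h set_val (I :|: [set (g, h)]) = set_val I.
Proof.
have [-> _|I0 leI] := eqVneq I set0.
  under eq_bigr => h _ do rewrite set0U set_val1.
  rewrite set_val0 -(ts_row sol [ffun=> g]) [RHS](sum_const c_) // => k c d nz.
  by apply/eqP; rewrite -(ts_eq sol c d nz) !ffunE.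
have [x [k [c0 [c1 [cc xx kk -> e]]]]] := set_val_upd I0 leI.
under eq_bigr => h _ do rewrite e.
(* The sum moves to the [G] side, where the repetition in [k] leaves a single term. *)
rewrite -bal; under eq_bigr => w _ do rewrite upd_upd.
by rewrite (sum_dup_l _ cc kk) -xx upd_id.
Qed.

Lemma set_val_col (I : {set G * H}) h : (#|I| <= 2 * t - 1)%N ->
  \sum_g set_val (I :|: [set (g, h)]) = set_val I.
Proof.
have [-> _|I0 leI] := eqVneq I set0.
  under eq_bigr => g _ do rewrite set0U set_val1.
  rewrite set_val0 -(ts_col sol [ffun=> h]) [RHS](sum_const c_) // => x c d nz.
  by apply/eqP; rewrite (ts_eq sol c d nz) !ffunE.
have [x [k [c0 [c1 [cc xx kk -> e]]]]] := set_val_upd I0 leI.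
under eq_bigr => g _ do rewrite e.
rewrite bal; under eq_bigr => w _ do rewrite upd_upd.
by rewrite (sum_dup_r _ cc xx) -kk upd_id.
Qed.

Lemma set_val_iso (I : {set G * H}) : (#|I| <= 2 * t)%N -> ~ partial_iso I ->
  set_val I = 0.
Proof.
move=> leI npi; have [I0|I0] := eqVneq I set0.
  by case: npi => p q; rewrite I0 inE.
have [l lI] := img_surj I0 leI; rewrite -{}lI in npi *; rewrite set_val_img.
apply/eqP/negPn/negP=> nz; apply: npi => p q /imsetP[c _ ->] /imsetP[d _ ->].
have := ts_eq sol c d nz; have := ts_edge sol c d nz; rewrite !ffunE => -> e2.
by split=> //; split=> /eqP; rewrite ?e2 => h; apply/eqP; rewrite -?e2 ?h // e2.
Qed.

Lemma half_surj (I : {set G * H}) : I != set0 -> (#|I| <= t)%N ->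
  exists p : {ffun 'I_t -> G} * {ffun 'I_t -> H}, [set (p.1 i, p.2 i) | i : 'I_t] = I.
Proof.
case/set0Pn=> p pI leI; pose f (i : 'I_t) := nth p (enum I) i.
exists ([ffun i => (f i).1], [ffun i => (f i).2]); apply/setP=> q; apply/imsetP/idP => /=.
  case=> i _ ->; rewrite !ffunE -surjective_pairing /f.
  have [lt|ge] := ltnP i (size (enum I)).
    by rewrite -mem_enum mem_nth.
  by rewrite nth_default.
rewrite -mem_enum => qI; have lt : (index q (enum I) < t)%N.
  by apply: leq_trans leI; rewrite cardE index_mem.
by exists (Ordinal lt); rewrite // !ffunE -surjective_pairing /f /= nth_index.
Qed.

Lemma set_val_join (p q : {ffun 'I_t -> G} * {ffun 'I_t -> H}) :
  C (fjoin p.1 q.1) (fjoin p.2 q.2) =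
  set_val ([set (p.1 i, p.2 i) | i : 'I_t] :|: [set (q.1 i, q.2 i) | i : 'I_t]).
Proof.
pose l : {ffun ctx t -> G * H} := [ffun c => (fjoin p.1 q.1 c, fjoin p.2 q.2 c)].
have -> : [set (p.1 i, p.2 i) | i : 'I_t] :|: [set (q.1 i, q.2 i) | i : 'I_t] = img l.
  apply/setP=> z; rewrite inE; apply/orP/imsetP => [[] /imsetP[i _ ->]|[[i|i] _ ->]].
  - by exists (inl i); rewrite ?ffunE.
  - by exists (inr i); rewrite ?ffunE.
  - by left; apply/imsetP; exists i; rewrite ?ffunE.
  - by right; apply/imsetP; exists i; rewrite ?ffunE.
rewrite set_val_img /val_of.
by congr C; apply/ffunP=> c; rewrite !ffunE.
Qed.

(* The Gram vector of the empty set is [sum_h v_(g0, h)] for any fixed tuple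
   [g0]. *)
Lemma set_val_psd (w : set_le (G * H)%type t -> R) :
  0 <= \sum_I \sum_J w I * w J * set_val (val I :|: val J).
Proof.
have [g0 _|G0] := pickP (@predT G); last first.
  have E (I : {set G * H}) : I = set0.
    by apply/setP=> -[g h]; have := G0 g.
  suff -> : \sum_I \sum_J w I * w J * set_val (val I :|: val J) = (\sum_I w I) ^+ 2.
    exact: sqr_ge0.
  rewrite expr2 mulr_suml; apply: eq_bigr => I _; rewrite mulr_sumr.
  by apply: eq_bigr => J _; rewrite [_ :|: _]E set_val0 mulr1.
pose P := ({ffun 'I_t -> G} * {ffun 'I_t -> H})%type.
have ex (I : set_le (G * H)%type t) : exists p : P,
    val I != set0 -> [set (p.1 i, p.2 i) | i : 'I_t] = val I.
  have [->|I0] := eqVneq (val I) set0; last first.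
    by have [p pI] := half_surj I0 (valP I); exists p.
  have [h _|H0] := pickP (@predT H); first by exists ([ffun=> g0], [ffun=> h]).
  (* If [H] were empty, this row sum would be [0]. *)
  have := ts_row sol [ffun=> g0]; rewrite big1 => [/eqP|k _].
    by rewrite eq_sym oner_eq0.
  by have := H0 (k c_).
have [tup tupE] := choice ex.
pose cf (I : set_le (G * H)%type t) (p : P) : R :=
  if val I == set0 then (p.1 == [ffun=> g0])%:R else (p == tup I)%:R.
have := psd_congr cf (ts_psd sol) w; congr (_ <= _).
apply: eq_bigr => I _; apply: eq_bigr => J _; congr (_ * _).
have cfE0 (K : set_le (G * H)%type t) (F : P -> R) : val K = set0 ->
    \sum_p cf K p * F p = \sum_h F ([ffun=> g0], h).
  move=> K0; rewrite big_pair_sep exchange_big; apply: eq_bigr => h _.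
  rewrite -[RHS](sum_delta [ffun=> g0] (fun g => F (g, h))).
  by apply: eq_bigr => g _; rewrite /cf K0 eqxx.
have cfE (K : set_le (G * H)%type t) (F : P -> R) : val K != set0 ->
    \sum_p cf K p * F p = F (tup K).
  move=> K0; rewrite -[RHS](sum_delta (tup K) F).
  by apply: eq_bigr => p _; rewrite /cf (negbTE K0).
under eq_bigr => p _ do (under eq_bigr => q _ do rewrite -mulrA);
  under eq_bigr => p _ do rewrite -mulr_sumr.
have join_const g : fjoin [ffun=> g] [ffun=> g] = [ffun=> g] :> {ffun ctx t -> G}.
  by apply/ffunP=> -[i|i]; rewrite !ffunE.
have constE : \sum_h \sum_h' C (fjoin [ffun=> g0] [ffun=> g0]) (fjoin h h') = 1.
  by rewrite join_const -[RHS](ts_row sol [ffun=> g0]) big_fjoin.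
(* By [ts_eq] only constant [h] contribute, and what remains is a marginal sum. *)
have emptyE (p : P) : (#|[set (p.1 i, p.2 i) | i : 'I_t]| <= 2 * t - 1)%N ->
    \sum_h C (fjoin [ffun=> g0] p.1) (fjoin h p.2) =
    set_val [set (p.1 i, p.2 i) | i : 'I_t].
  move=> lep; rewrite -(set_val_row g0 lep) (sum_const (Ordinal t0)); last first.
    move=> h d e nz; have := ts_eq sol (inl d) (inl e) nz; rewrite !ffunE eqxx.
    by move/esym/eqP.
  apply: eq_bigr => h _; rewrite (set_val_join ([ffun=> g0], [ffun=> h]) p) /= setUC.
  congr (set_val (_ :|: _)); apply/setP=> q; rewrite inE; apply/imsetP/eqP => [[i _ ->]|->].
    by rewrite !ffunE.
  by exists (Ordinal t0); rewrite // !ffunE.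
have le_t (K : set_le (G * H)%type t) : (#|val K| <= 2 * t - 1)%N.
  by apply: leq_trans (valP K) _; clear -t0; lia.
have [I0|I0] := eqVneq (val I) set0; have [J0|J0] := eqVneq (val J) set0.
- rewrite cfE0 // I0 J0 setU0 set_val0 -constE; apply: eq_bigr => h _.
  by rewrite cfE0.
- rewrite cfE0 // I0 set0U; under eq_bigr => h _ do rewrite cfE //=.
  by rewrite emptyE tupE.
- rewrite cfE // J0 setU0 cfE0 //=.
  under eq_bigr => h _ do rewrite (ts_swap sol).
  by rewrite emptyE tupE.
- by rewrite !cfE // set_val_join !tupE.
Qed.

Theorem tuple_solution_lasserre : lasserre_solution t set_val.
Proof.
split.
- split.
    apply/is_hermitianmxP; rewrite expr0 scale1r.
    by apply/matrixP=> i j; rewrite !mxE setUC.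
  move=> x; rewrite moment_quad.
  exact: (set_val_psd (fun I => x (enum_rank I) 0)).
- move=> I g leI; apply: set_val_row; apply: leq_trans leI _.
  by apply: leq_sub2l.
- move=> I h leI; apply: set_val_col; apply: leq_trans leI _.
  by apply: leq_sub2l.
- exact: set_val_iso.
- exact: set_val0.
Qed.

End ToLasserre.

(** * The equivalence *)

Lemma tuple_solution_card (R : realFieldType) (t : nat) (G H : graph)
    (Z : {ffun ctx t -> G} -> {ffun ctx t -> H} -> R) :
  (0 < t)%N -> tuple_solution Z -> #|G| = #|H|.
Proof.
move=> t0 sol; have := tuple_solution_sum_ev (s := Leaf) tt sol.
under eq_bigr => x _ do rewrite ev_leaf; under [RHS]eq_bigr => x _ do rewrite ev_leaf.
rewrite !sum1_card !card_ffun => /eqP; rewrite eqn_exp2r ?card_ctx ?muln_gt0 //.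
by move/eqP.
Qed.

Lemma hom_empty (F G : graph) : #|G| = 0%N -> Defs.hom F G = (0 ^ #|F|)%N.
Proof.
move=> G0; rewrite -G0 -card_ffun -cardsT; congr #|pred_of_set _|; apply/setP=> f.
rewrite !inE; apply/forallP=> u.
by have := card0_eq G0 (f u).
Qed.

Close Scope ring_scope.

Theorem theorem1p2 (R : realType) (t : nat) (ht : 1 <= t) :
  exists L : graph -> Prop,
    [/\ minor_closed L,
        forall F : graph, L F -> treewidth_at_most (3 * t - 1) F &
        forall G H : graph, simple G -> simple H ->
          (lasserre_feasible R t G H <-> hom_indistinguishable L G H)].
Proof.
exists (lasserre_class t); split; first exact: lasserre_class_minor.
  by move=> F [s Fs]; apply: treewidth_minor Fs (scheme_treewidth s ht).
move=> G H _ _; split=> [[y ysol] F [s Fs]|ind].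
  have sol := lasserre_tuple_solution ht ysol.
  have card := tuple_solution_card ht sol.
  have [a [c [c0 homE]]] := hom_minor_ev Fs.
  (* The factor [c #|G|] can be cancelled only when [G] is nonempty. *)
  have [G0|G0] := posnP #|G|; first by rewrite !hom_empty // -card.
  apply/eqP; rewrite -(eqn_pmul2r (c0 _ G0)) homE card homE.
  by rewrite (tuple_solution_sum_ev a sol).
have sums (r : term t) :
    \sum_(x : {ffun ctx t -> G}) tev r x = \sum_(k : {ffun ctx t -> H}) tev r k.
  (* The sum of a term is the homomorphism number of its quotient graph, a member of the class. *)
  rewrite /tev -!hom_quo; apply: ind; exists (projT1 r).
  exact: quo_minor.
have [C [sol bal]] := exists_tuple_solution R sums.
by exists (set_val C); apply: tuple_solution_lasserre.
Qed.
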